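(* Let $\alpha\in(1,2)$ and let $X$ be an $\alpha$-stable random variable with Lévy measure $$\nu(du)=\left(c_1\frac{1}{u^{\alpha+1}}\mathbf{1}_{(0,+\infty)}(u)+c_2\frac{1}{|u|^{\alpha+1}}\mathbf{1}_{(-\infty,0)}(u)\right)du,$$ where $c_1,c_2\ge0$ are such that $c_1+c_2>0$, and with characteristic function $\varphi$. Let $X_n$, $n\ge1$, be compound Poisson random variables each having characteristic function $$\varphi_n(t)=\exp\left(n\left((\varphi(t))^{\frac1n}-1\right)\right),\qquad t\in\mathbb{R}.$$ Then $$d_K(X_n,X)\le C\,\frac{1}{n^{\frac{1}{\alpha+1}}},$$ where $C>0$ depends only on $\alpha$, $c_1$ and $c_2$.
   Context: That $X$ is $\alpha$-stable with Lévy measure $\nu$ means that, for some $b\in\mathbb{R}$, $\varphi(t)=\mathbb{E}e^{itX}=\exp\big(itb+\int(e^{itu}-1-itu\mathbf{1}_{|u|\le1})\nu(du)\big)$ for all $t\in\mathbb{R}$; $(\varphi(t))^{1/n}$ is the exponential of $1/n$ times this exponent. $d_K(X,Y)=\sup_{x\in\mathbb{R}}|\mathbb{P}(X\le x)-\mathbb{P}(Y\le x)|$.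
   Formalization: The constant C is allowed to depend also on the drift b of X, besides α, c1 and c2; a constant uniform in b cannot exist (take b=√n, where X_n−b acquires an extra Gaussian component in the limit). *)

(* Defs.v *)
From HB Require Import structures.
From mathcomp Require Export all_boot all_order all_algebra complex.
From mathcomp Require Export all_classical all_reals all_analysis.
From mathcomp Require Import measurable_realfun.

Set Implicit Arguments.
Unset Strict Implicit.
Unset Printing Implicit Defensive.

Import Order.TTheory GRing.Theory Num.Theory.
Import numFieldNormedType.Exports.

Local Open Scope classical_set_scope.
Local Open Scope ring_scope.
Local Open Scope complex_scope.

Definition expC (R : realType) (z : R[i]) : R[i] :=
  (expR (complex.Re z) * cos (complex.Im z)) +i*
  (expR (complex.Re z) * sin (complex.Im z)).

(* As with [Rintegral], meaningful when the real and imaginary parts of [f]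
   are integrable. *)
Definition Cintegral d (T : measurableType d) (R : realType)
    (mu : {measure set T -> \bar R}) (f : T -> R[i]) : R[i] :=
  (\int[mu]_x complex.Re (f x)) +i* (\int[mu]_x complex.Im (f x)).

Definition charfun d (T : measurableType d) (R : realType)
    (P : {measure set T -> \bar R}) (X : T -> R) (t : R) : R[i] :=
  Cintegral P (fun w => expC ('i * (t * X w)%:C)).

Section stable_levy_measure.
Context (R : realType) (alpha : R) (c1 c2 : {nonneg R}).

Definition stable_levy_density (u : R) : R :=
  c1%:num * (u `^ (alpha + 1))^-1 * \1_(`]0, +oo[%classic) u +
  c2%:num * (`|u| `^ (alpha + 1))^-1 * \1_(`]-oo, 0[%classic) u.

Lemma stable_levy_density_ge0 u : 0 <= stable_levy_density u.
Proof. by rewrite addr_ge0 // !mulr_ge0 // invr_ge0 powR_ge0. Qed.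

Lemma measurable_stable_levy_density :
  measurable_fun [set: R] stable_levy_density.
Proof.
have mV (f : R -> R) : measurable_fun setT f ->
    measurable_fun setT (fun u => (f u `^ (alpha + 1))^-1).
  move=> mf; under eq_fun do rewrite -powRN.
  exact: measurableT_comp (measurable_powR _) mf.
apply: measurable_funD; apply: measurable_funM => //.
- by apply: measurable_funM => //; exact: mV.
- by apply: measurable_funM => //; exact: mV.
Qed.

Definition stable_levy (A : set R) : \bar R :=
  (\int[lebesgue_measure]_(u in A) (stable_levy_density u)%:E)%E.

Let stable_levy0 : stable_levy set0 = 0%E.
Proof. by rewrite /stable_levy integral_set0. Qed.

Let stable_levy_ge0 A : (0 <= stable_levy A)%E.
Proof.
by apply: integral_ge0 => u _; rewrite lee_fin stable_levy_density_ge0.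
Qed.

Let stable_levy_sigma_additive : semi_sigma_additive stable_levy.
Proof.
move=> F mF tF mUF; rewrite /stable_levy; apply: cvg_toP.
  apply: ereal_nondecreasing_is_cvgn => m n mn.
  apply: lee_sum_nneg_natr => // k _ _; apply: integral_ge0 => u _.
  by rewrite lee_fin stable_levy_density_ge0.
rewrite ge0_integral_bigcup//=.
- apply/measurable_funTS/measurableT_comp => //.
  exact: measurable_stable_levy_density.
- by move=> u _; rewrite lee_fin stable_levy_density_ge0.
Qed.

HB.instance Definition _ := isMeasure.Build _ _ _ stable_levy
  stable_levy0 stable_levy_ge0 stable_levy_sigma_additive.

End stable_levy_measure.

Definition levy_exponent (R : realType) (b : R)
    (nu : {measure set R -> \bar R}) (t : R) : R[i] :=
  'i * (t * b)%:C +
  Cintegral nu (fun u : R => expC ('i * (t * u)%:C) - 1 -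
    'i * (t * u * \1_[set v : R | `|v| <= 1] u)%:C).

Definition stable_cf (R : realType) (alpha : R) (c1 c2 : {nonneg R}) (b t : R)
    : R[i] :=
  expC (levy_exponent b (stable_levy alpha c1 c2) t).

(* The n-th root of [stable_cf] that is itself a characteristic function; in
   general it is not the principal root. *)
Definition stable_cf_root (R : realType) (alpha : R) (c1 c2 : {nonneg R})
    (b : R) (n : nat) (t : R) : R[i] :=
  expC (n%:R^-1 * levy_exponent b (stable_levy alpha c1 c2) t).

(* The law of [X] is that of a Poisson([lam]) number of independent jumps with
   law [sigma], none of them zero. *)
Definition compound_poisson d (T : measurableType d) (R : realType)
    (P : probability T R) (X : {RV P >-> R}) : Prop :=
  exists (lam : R) (sigma : probability R R),
    [/\ 0 < lam, sigma [set 0] = 0%E &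
        forall t, charfun P X t = expC (lam%:C * (charfun sigma idfun t - 1))].

Definition dK d (T : measurableType d) d' (T' : measurableType d')
    (R : realType) (P : probability T R) (Q : probability T' R)
    (X : {RV P >-> R}) (Y : {RV Q >-> R}) : R :=
  sup (range (fun x : R => `|fine (cdf X x) - fine (cdf Y x)|)).

(* Main.v *)
(* Write phi = exp psi and phi_n = exp psi_n. Since alpha lies in (1, 2), psi is
   O(t + t^2), and Re psi <= - k t^alpha because nu charges the scale 1 / t. As
   |psi_n - psi| = O(|psi|^2 / n), and as both phi and phi_n decay exponentially
   on [0, L] for L = n^(1 / (alpha + 1)), one gets |phi_n - phi| = O(t / n) there.
   The Fejer kernel at scale 1 / L, whose Fourier transform is supported in
   [-L, L], then gives the Esseen-type bound d_K = O(1 / L + L / n): smoothed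
   distribution functions differ by O(L / n), and a gap between distribution
   functions of a larger order than 1 / L would survive the smoothing, because
   phi is integrable, so that the distribution function of X is Lipschitz.
   Characteristic functions are handled through the real functions E cos(tX) and
   E sin(tX). *)
From mathcomp Require Import ring lra measurable_realfun.
Require Import Defs.

Set Implicit Arguments.
Unset Strict Implicit.
Unset Printing Implicit Defensive.

Import Order.TTheory GRing.Theory Num.Theory.
Import numFieldNormedType.Exports.

Local Open Scope classical_set_scope.
Local Open Scope ring_scope.

(** * Elementary inequalities *)

Section elementary_inequalities.
Context {R : realType}.
Implicit Types x y t : R.

(** The frequency range must be cut at [L] because [phi_n] does not tend to 0: a compound Poisson
    law has an atom at 0, and [Re psi_n >= - 2 n]. Only while [t^alpha] is at most of order [n] does
    [Re psi_n] inherit the decay of [Re psi]. The cut-off [L = n^(1 / (alpha + 1))] respects this,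
    as [L^alpha <= n]; it also satisfies [L^2 <= n], which makes [L / n] at most [1 / L]. Passing
    from densities to distribution functions divides the transform by [t]; this is why the
    difference of characteristic functions is estimated by a multiple of [t] and not just by a
    constant. To keep every integral absolutely convergent, no inversion formula is used: the
    smoothed object is the mass of an interval []z, x]], with a bound uniform in [z], and [z] is
    then taken so far to the left that its contribution is a small fraction of the gap. The two laws
    enter asymmetrically. The distribution function of [X_n] is only known to be monotone, so a
    positive gap is followed to the right and a negative one to the left, and the Lipschitz bound is
    asked of [X] alone. *)

Lemma is_derive_MVT (f df : R -> R) x y :
  (forall z : R, is_derive z 1 f (df z)) ->
  exists2 c, (x <= c <= y) || (y <= c <= x) & f y - f x = df c * (y - x).
Proof.
move=> fdf.
have cf a b : {within `[a, b], continuous f}.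
  apply: continuous_subspaceT => z.
  by apply/differentiable_continuous/derivable1_diffP; have [] := fdf z.
have [xy|/ltW yx] := leP x y.
- have [c cxy E] := @MVT_segment _ f df x y xy (fun z _ => fdf z) (cf _ _).
  by exists c => //; rewrite in_itv/= in cxy; rewrite cxy.
- have [c cxy E] := @MVT_segment _ f df y x yx (fun z _ => fdf z) (cf _ _).
  exists c; first by rewrite in_itv/= in cxy; rewrite cxy orbT.
  by rewrite -opprB E -mulrN opprB.
Qed.

Lemma cos_lipschitz x y : `|cos x - cos y| <= `|x - y|.
Proof.
have [c _ ->] := @is_derive_MVT cos (- sin) y x (@is_derive_cos R).
by rewrite normrM -[leRHS]mul1r ler_wpM2r// normrN sin_max.
Qed.

Lemma sin_lipschitz x y : `|sin x - sin y| <= `|x - y|.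
Proof.
have [c _ ->] := @is_derive_MVT sin cos y x (@is_derive_sin R).
by rewrite normrM -[leRHS]mul1r ler_wpM2r// cos_max.
Qed.

Lemma sin_le_norm x : `|sin x| <= `|x|.
Proof. by have := sin_lipschitz x 0; rewrite sin0 !subr0. Qed.

Lemma onem_cos_le_norm x : `|1 - cos x| <= `|x|.
Proof. by have := cos_lipschitz x 0; rewrite cos0 distrC subr0. Qed.

(** The mean value theorem gives [|sin c| |x|] with [|sin c| <= |c| <= |x|]. The sharp factor 1/2 is
    given up, here and below, since constants are free. *)
Lemma onem_cos_le_sqr x : 1 - cos x <= x ^+ 2.
Proof.
have [c cx] := @is_derive_MVT cos (- sin) x 0 (@is_derive_cos R).
rewrite cos0 => ->; rewrite sub0r; apply: le_trans (ler_norm _) _.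
rewrite normrM !normrN -[leRHS]ger0_norm ?sqr_ge0// expr2 normrM ler_wpM2r//.
apply: (le_trans (sin_le_norm _)); rewrite ler_norml.
by case: (ger0P x) => x0; case/orP: cx => /andP[] ? ?; apply/andP; split; lra.
Qed.

Lemma sinB_le_sqr x : `|sin x - x| <= x ^+ 2.
Proof.
have [c cx] := @is_derive_MVT (fun x => sin x - x) (fun z => cos z - 1) 0 x
  (fun z => is_deriveB (is_derive_sin z) (is_derive_id z 1)).
rewrite sin0 !subr0 => ->.
rewrite normrM -[leRHS]ger0_norm ?sqr_ge0// expr2 normrM ler_wpM2r//.
rewrite distrC; apply: (le_trans (onem_cos_le_norm _)); rewrite ler_norml.
by case: (ger0P x) => x0; case/orP: cx => /andP[] ? ?; apply/andP; split; lra.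
Qed.

(** Half-angle formula: for [y = x / 2], [|y| <= 1/2], the bound [|sin y - y| <= y^2] leaves
    [|sin y| >= |y| / 2 = |x| / 4], and [2 (x / 4)^2 = x^2 / 8]. *)
Lemma sqr_le_onem_cos x : `|x| <= 1 -> x ^+ 2 / 8 <= 1 - cos x.
Proof.
move=> x1.
have -> : 1 - cos x = 2 * (sin (x / 2)) ^+ 2.
  have {1}-> : x = (x / 2) *+ 2 by rewrite -mulr_natr -mulrA mulVf ?mulr1.
  rewrite cos_mulr2n -[LHS]/(1 - _ ) cos2sin2; ring.
have := sinB_le_sqr (x / 2); set s := sin _; rewrite ler_norml => /andP[s1 s2].
move: x1; rewrite ler_norml => /andP[x1 x2].
have [x0|x0] := leP 0 x.
- have h : x / 4 <= s by nra.
  by nra.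
- have h : s <= x / 4 by nra.
  by nra.
Qed.

Lemma expRB1_le x : x <= 0 -> `|expR x - 1| <= `|x|.
Proof.
move=> x0; rewrite !ler0_norm// ?subr_le0 ?expR_le1//.
by have := expR_ge1Dx x; lra.
Qed.

Lemma expRB1Dx_le x : x <= 0 -> `|expR x - 1 - x| <= x ^+ 2.
Proof.
move=> x0.
have [c cx] := @is_derive_MVT (fun x => expR x - x) (fun z => expR z - 1) 0 x
  (fun z => is_deriveB (is_derive_expR z) (is_derive_id z 1)).
rewrite expR0 !subr0 => E.
have -> : expR x - 1 - x = (expR c - 1) * x by rewrite -E; ring.
rewrite normrM -[leRHS]ger0_norm ?sqr_ge0// expr2 normrM ler_wpM2r//.
have c0 : x <= c <= 0 by case/orP: cx => // /andP[] ? ?; apply/andP; split; lra.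
case/andP: c0 => xc c0.
apply: (le_trans (expRB1_le c0)); rewrite !ler0_norm//; lra.
Qed.

Lemma expR_lipschitz_max x y M : expR x <= M -> expR y <= M ->
  `|expR x - expR y| <= M * `|x - y|.
Proof.
move=> xM yM.
have [c cxy ->] := is_derive_MVT y x (@is_derive_expR R).
rewrite normrM ler_wpM2r// ger0_norm ?expR_ge0//.
case/orP: cxy => /andP[_] cxy.
  by rewrite (le_trans _ xM)// ler_expR.
by rewrite (le_trans _ yM)// ler_expR.
Qed.

(** Real part of [|e^z - e^w| <= M |z - w|] when both exponentials have modulus at most [M]; the
    sine version below is the imaginary part. This turns closeness of exponents into closeness of
    characteristic functions without losing their decay. *)
Lemma expR_cos_lipschitz a p b q (M : R) : expR a <= M -> expR b <= M ->
  `|expR a * cos p - expR b * cos q| <= M * (`|a - b| + `|p - q|).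
Proof.
move=> aM bM.
have -> : expR a * cos p - expR b * cos q =
  (expR a - expR b) * cos p + expR b * (cos p - cos q) by ring.
apply: (le_trans (ler_normD _ _)); rewrite [leRHS]mulrDr !normrM; apply: lerD.
  rewrite -[leRHS]mulr1 ler_pM ?cos_max//; exact: expR_lipschitz_max.
by rewrite ler_pM ?cos_lipschitz// ger0_norm ?expR_ge0.
Qed.

Lemma expR_sin_lipschitz a p b q (M : R) : expR a <= M -> expR b <= M ->
  `|expR a * sin p - expR b * sin q| <= M * (`|a - b| + `|p - q|).
Proof.
move=> aM bM.
have -> : expR a * sin p - expR b * sin q =
  (expR a - expR b) * sin p + expR b * (sin p - sin q) by ring.
apply: (le_trans (ler_normD _ _)); rewrite [leRHS]mulrDr !normrM; apply: lerD.
  rewrite -[leRHS]mulr1 ler_pM ?sin_max//; exact: expR_lipschitz_max.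
by rewrite ler_pM ?sin_lipschitz// ger0_norm ?expR_ge0.
Qed.

(** Real part of the second-order bound on [e^z - 1 - z] in the half-plane [Re z <= 0], where no
    exponential factor appears. *)
Lemma expR_cosB1_le x y : x <= 0 ->
  `|expR x * cos y - 1 - x| <= x ^+ 2 + y ^+ 2.
Proof.
move=> x0.
have -> : expR x * cos y - 1 - x =
  (expR x - 1 - x) - expR x * (1 - cos y) by ring.
apply: (le_trans (ler_normB _ _)); apply: lerD; rewrite ?expRB1Dx_le// normrM.
rewrite ger0_norm ?expR_ge0// -[leRHS]mul1r.
by rewrite ler_pM ?expR_ge0// ?expR_le1// ger0_norm ?onem_cos_le_sqr//
  subr_ge0 cos_le1.
Qed.

(** Imaginary part of the same expansion; the factor 2 absorbs the cross term [|x| |y|]. *)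
Lemma expR_sinB_le x y : x <= 0 ->
  `|expR x * sin y - y| <= 2 * (x ^+ 2 + y ^+ 2).
Proof.
move=> x0.
have -> : expR x * sin y - y =
  expR x * (sin y - y) + (expR x - 1) * y by ring.
rewrite (le_trans (ler_normD _ _))//.
have h1 : `|expR x * (sin y - y)| <= y ^+ 2.
  rewrite normrM ger0_norm ?expR_ge0// -[leRHS]mul1r.
  by rewrite ler_pM ?expR_ge0// ?expR_le1// sinB_le_sqr.
have h2 : `|(expR x - 1) * y| <= `|x| * `|y|.
  by rewrite normrM ler_wpM2r// expRB1_le.
rewrite -[in leRHS](real_normK (num_real x)).
rewrite -[in leRHS](real_normK (num_real y)).
rewrite -(real_normK (num_real y)) in h1.
have := sqr_ge0 (`|x| - `|y|); nra.
Qed.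

(** Cube the inequality [m (1 + t) <= 1 + k t / 3 <= e^(k t / 3)]. The power 3 is what remains of
    [|psi|^2 = O((t + t^2)^2)] once a factor [t] is set aside. *)
Lemma expRN_cube_bounded (k : R) : 0 < k ->
  exists2 B, 0 < B & forall t, 0 <= t -> (1 + t) ^+ 3 * expR (- (k * t)) <= B.
Proof.
move=> k0; pose m := Num.min 1 (k / 3).
have m0 : 0 < m by rewrite lt_min ltr01 divr_gt0.
exists ((m ^+ 3)^-1) => [|t t0]; first by rewrite invr_gt0 exprn_gt0.
have h : (m * (1 + t)) ^+ 3 <= expR (k * t).
  have -> : k * t = (k / 3 * t) * 3%:R by field.
  rewrite expRM_natr; apply: lerXn2r; rewrite ?nnegrE ?expR_ge0//.
    by rewrite mulr_ge0 ?ltW//; lra.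
  apply: le_trans (expR_ge1Dx _).
  rewrite mulrDr mulr1; apply: lerD; first by rewrite ge_min lexx.
  by rewrite ler_wpM2r// ge_min lexx orbT.
rewrite expRN ler_pdivrMr ?expR_gt0// ler_pdivlMl ?exprn_gt0//.
by rewrite -exprMn.
Qed.

End elementary_inequalities.

(** * Integration *)

Section integration_facts.
Context {R : realType}.
Local Notation mu := (@lebesgue_measure R).

Lemma integrable_bounded d (T : measurableType d)
    (nu : {measure set T -> \bar R}) (D : set T) (f : T -> R) (C : R) :
  measurable D -> (nu D < +oo)%E -> measurable_fun D f ->
  (forall x, D x -> `|f x| <= C) -> nu.-integrable D (EFin \o f).
Proof.
move=> mD Doo mf fC; apply: measurable_bounded_integrable => //.
exists C; split; first exact: num_real.
by move=> M CM x Dx; exact: le_trans (fC x Dx) (ltW CM).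
Qed.

Lemma Rintegral_fubini_bounded d1 d2 (T1 : measurableType d1)
    (T2 : measurableType d2) (m1 : {sigma_finite_measure set T1 -> \bar R})
    (m2 : {sigma_finite_measure set T2 -> \bar R}) (D1 : set T1) (D2 : set T2)
    (f : T1 -> T2 -> R) (C : R) :
  measurable D1 -> measurable D2 -> (m1 D1 < +oo)%E -> (m2 D2 < +oo)%E ->
  measurable_fun (D1 `*` D2) (fun z => f z.1 z.2) ->
  (forall x y, D1 x -> D2 y -> `|f x y| <= C) ->
  \int[m1]_(x in D1) (\int[m2]_(y in D2) f x y) =
  \int[m2]_(y in D2) (\int[m1]_(x in D1) f x y).
Proof.
move=> mD1 mD2 D1oo D2oo mf fC.
have mD : measurable (D1 `*` D2) by exact: measurableX.
(* Extension by zero outside [D1 * D2] reduces the claim to Fubini on the whole product. *)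
pose g := (fun z => f z.1 z.2) \_ (D1 `*` D2).
have ig : (m1 \x m2)%E.-integrable setT (EFin \o g).
  rewrite -restrict_EFin; apply/(integrable_mkcond _ mD).1.
  apply: (@integrable_bounded _ _ _ _ _ C) => //.
    by rewrite /= product_measure1E// lte_mul_pinfty ?ge0_fin_numE.
  by move=> [x y] [/= Dx Dy]; exact: fC.
have i1 x : D1 x -> m2.-integrable D2 (EFin \o f x).
  move=> Dx; apply: (@integrable_bounded _ _ _ _ _ C) => [//|//||y Dy].
    have -> : f x = (fun z => f z.1 z.2) \o pair x by [].
    apply: (measurable_comp mD) => //; first by move=> _ [y Dy <-].
    exact: measurable_funTS.
  exact: fC.
have i2 y : D2 y -> m1.-integrable D1 (EFin \o f ^~ y).
  move=> Dy; apply: (@integrable_bounded _ _ _ _ _ C) => [//|//||x Dx].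
    have -> : f ^~ y = (fun z => f z.1 z.2) \o (pair ^~ y) by [].
    apply: (measurable_comp mD) => //; first by move=> _ [x Dx <-].
    exact: measurable_funTS.
  exact: fC.
have E := Fubini ig.
have gE x y : D1 x -> D2 y -> g (x, y) = f x y.
  by move=> Dx Dy; rewrite /g patchE mem_set.
have g0 x y : ~ (D1 x /\ D2 y) -> g (x, y) = 0.
  by move=> nD; rewrite /g patchE memNset.
rewrite [RHS]/Rintegral [LHS]/Rintegral; congr fine.
transitivity (\int[m1]_x \int[m2]_y (g (x, y))%:E)%E; last first.
  rewrite [LHS]E [RHS]integral_mkcond; apply: eq_integral => y _.
  rewrite patchE; case: ifPn => [/set_mem Dy|/negP nDy].
    rewrite /Rintegral fineK; last exact/integrable_fin_num/i2.
    rewrite [RHS]integral_mkcond; apply: eq_integral => x _.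
    rewrite patchE; case: ifPn => [/set_mem Dx|/negP nDx]; first by rewrite /= gE.
    by rewrite /= g0// => -[/mem_set].
  by apply: integral0_eq => x _; rewrite /= g0// => -[_ /mem_set].
rewrite [LHS]integral_mkcond; apply: eq_integral => x _.
rewrite patchE; case: ifPn => [/set_mem Dx|/negP nDx].
  rewrite /Rintegral fineK; last exact/integrable_fin_num/i1.
  rewrite [LHS]integral_mkcond; apply: eq_integral => y _.
  rewrite patchE; case: ifPn => [/set_mem Dy|/negP nDy]; first by rewrite /= gE.
  by rewrite /= g0// => -[_ /mem_set].
by apply/esym/integral0_eq => y _; rewrite /= g0// => -[/mem_set].
Qed.

Lemma is_derive_continuous (F f : R -> R) :
  (forall x : R, is_derive x 1 F (f x)) -> continuous F.
Proof.
move=> Ff x.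
by apply/differentiable_continuous/derivable1_diffP; have [] := Ff x.
Qed.

Lemma continuous_itv_integrable (f : R -> R) (a b : R) : continuous f ->
  mu.-integrable `[a, b] (EFin \o f).
Proof.
move=> cf; apply: continuous_compact_integrable; first exact: segment_compact.
exact: continuous_subspaceT.
Qed.

Lemma Rintegral_FTC (F f : R -> R) (a b : R) : a <= b ->
  (forall x : R, is_derive x 1 F (f x)) -> continuous f ->
  \int[mu]_(x in `[a, b]) f x = F b - F a.
Proof.
rewrite le_eqVlt => /predU1P[<-|ab] Ff cf.
  by rewrite set_itv1 Rintegral_set1 subrr.
have cF := is_derive_continuous Ff.
rewrite /Rintegral (@continuous_FTC2 _ f F)//.
- exact: continuous_subspaceT.
- split.
  + by move=> x _; have [] := Ff x.
  + exact/cvg_at_right_filter/cF.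
  + exact/cvg_at_left_filter/cF.
- by move=> x _; rewrite derive1E; have [] := Ff x.
Qed.

Lemma measurable_cos : measurable_fun setT (@cos R).
Proof. by apply: continuous_measurable_fun; exact: continuous_cos. Qed.

Lemma measurable_sin : measurable_fun setT (@sin R).
Proof. by apply: continuous_measurable_fun; exact: continuous_sin. Qed.

(** Written as [f * (f^2)^(-1)], the inverse becomes a measurable power of a nonnegative function;
    zeros of [f] give 0 on both sides by the convention on [0^-1]. *)
Lemma measurable_funV d (T : measurableType d) (D : set T) (f : T -> R) :
  measurable_fun D f -> measurable_fun D (fun x => (f x)^-1).
Proof.
move=> mf; have -> : (fun x => (f x)^-1) = (fun x => f x * (f x ^+ 2) `^ (-1)).
  apply/funext => x; have [->|fx0] := eqVneq (f x) 0; first by rewrite invr0 mul0r.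
  by rewrite powRN powRr1 ?sqr_ge0//; field.
apply: measurable_funM => //.
apply: (measurableT_comp (measurable_powR _)); exact: measurable_funX.
Qed.

(** Reflection preserves the length of intervals, so uniqueness of Lebesgue measure makes it
    invariant. *)
Lemma ge0_integral_oppr (f : R -> \bar R) (D : set R) : measurable D ->
  measurable_fun D f -> (forall x, D x -> 0 <= f x)%E ->
  (\int[mu]_(x in D) f x = \int[mu]_(x in -%R @^-1` D) f (- x)%R)%E.
Proof.
move=> mD mf f0.
have mN : measurable_fun setT (-%R : measurableTypeR R -> measurableTypeR R).
  exact: oppr_measurable.
rewrite -(ge0_integral_pushforward mN lebesgue_measure mD mf); last first.
  by move=> x /set_mem; exact: f0.
apply: eq_measure_integral => A mA _.
apply: (lebesgue_measure_unique (mu := pushforward lebesgue_measure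
  (-%R : measurableTypeR R -> measurableTypeR R))) => // _ [[a b] _ <-].
transitivity (mu `[- b, - a[%classic).
  by rewrite !lebesgue_measure_itv/= !lte_fin ltrN2 -!EFinB opprK addrC.
congr (mu _); apply/seteqP; split=> x /=; rewrite !in_itv/= lerNl ltrNr andbC//.
Qed.

Import HBNNSimple.

(** Change of measure for a density: monotone convergence reduces it to simple functions, and
    linearity to indicators, for which it is the hypothesis. *)
Lemma ge0_integral_density d (T : measurableType d)
    (la nu : {measure set T -> \bar R}) (h : T -> R) (f : T -> \bar R) :
  measurable_fun setT h -> (forall x, 0 <= h x) ->
  (forall A, measurable A -> nu A = \int[la]_(x in A) (h x)%:E)%E ->
  measurable_fun setT f -> (forall x, 0 <= f x)%E ->
  (\int[nu]_x f x = \int[la]_x (f x * (h x)%:E))%E.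
Proof.
move=> mh h0 nuE mf f0.
pose g := nnsfun_approx measurableT mf.
have mhE : measurable_fun setT (EFin \o h) by exact/measurable_EFinP.
have fE x : f x = lim ((EFin \o g n) x @[n --> \oo]).
  by apply/esym/cvg_lim => //; exact: cvg_nnsfun_approx.
have -> : (\int[nu]_x f x = lim (\int[nu]_x (EFin \o g n) x @[n --> \oo]))%E.
  under eq_integral do rewrite fE.
  apply: monotone_convergence => //.
  - by move=> n; apply/measurable_EFinP.
  - by move=> n x _; rewrite lee_fin.
  - by move=> x _ a b ab; rewrite lee_fin; exact/lefP/nd_nnsfun_approx.
have -> : (\int[la]_x (f x * (h x)%:E) =
    lim (\int[la]_x ((EFin \o g n) x * (h x)%:E) @[n --> \oo]))%E.
  have fhE x : (f x * (h x)%:E = lim ((EFin \o g n) x * (h x)%:E @[n --> \oo]))%E.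
    apply/esym/cvg_lim => //; apply: cvgeZr => //; exact: cvg_nnsfun_approx.
  under eq_integral do rewrite fhE.
  apply: monotone_convergence => //.
  - move=> n; apply: emeasurable_funM => //; exact/measurable_EFinP.
  - by move=> n x _; rewrite mule_ge0// lee_fin.
  - move=> x _ a b ab; rewrite lee_wpmul2r ?lee_fin//.
    exact/lefP/nd_nnsfun_approx.
congr (limn _); apply/funext => n /=.
transitivity (\int[nu]_x
   (\sum_(y \in range (g n)) (y * \1_(g n @^-1` [set y]) x)%:E))%E.
  by apply: eq_integral => t _; rewrite /= fimfunE -fsumEFin.
have mg r : measurable (g n @^-1` [set r]) by [].
have mI r : measurable_fun setT (fun x => (r * \1_(g n @^-1` [set r]) x)%:E).
  by apply/measurable_EFinP; exact: measurable_funM.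
rewrite ge0_integral_fsum//; last by move=> m y Ey; exact: nnfun_muleindic_ge0.
transitivity (\int[la]_x (\sum_(y \in range (g n))
    ((y * \1_(g n @^-1` [set y]) x)%:E * (h x)%:E)))%E; last first.
  apply: eq_integral => x _.
  rewrite -ge0_mule_fsuml => [|y]; last exact: nnfun_muleindic_ge0.
  by rewrite fsumEFin // -(fimfunE _ x).
rewrite ge0_integral_fsum//; last 2 first.
  - by move=> y; apply: emeasurable_funM.
  - move=> m y Ey; apply: mule_ge0; last by rewrite lee_fin.
    exact: nnfun_muleindic_ge0.
apply: eq_fsbigr => r rhn.
under eq_integral do rewrite EFinM.
rewrite integralZl_indic_nnsfun => //.
under [RHS]eq_integral do rewrite EFinM -muleA.
rewrite ge0_integralZl//.
- under [in RHS]eq_integral do rewrite muleC.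
  rewrite [in RHS](eq_integral ((EFin \o h) \_ (g n @^-1` [set r]))); last first.
    by move=> x _; rewrite epatch_indic.
  by rewrite -integral_mkcond -nuE// integral_indic// setIT.
- by apply: emeasurable_funM => //; exact/measurable_EFinP.
- by move=> t _; rewrite mule_ge0 ?lee_fin.
- by move: rhn; rewrite inE => -[t _ <-]; rewrite lee_fin.
Qed.

Lemma ge0_integral_bigcup_le d (T : measurableType d)
    (m : {measure set T -> \bar R}) (F : nat -> set T) (f : T -> \bar R)
    (C : \bar R) :
  nondecreasing_seq F -> (forall i, measurable (F i)) ->
  measurable_fun setT f -> (forall i x, F i x -> 0 <= f x)%E ->
  (forall i, \int[m]_(x in F i) f x <= C)%E ->
  (\int[m]_(x in \bigcup_i F i) f x <= C)%E.
Proof.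
move=> ndF mF mf f0 FC.
have mFf i : measurable_fun (F i) f by exact: measurable_funTS.
have cv := @ge0_nondecreasing_set_cvg_integral _ _ _ F f m ndF mF mFf f0.
rewrite -(cvg_lim _ cv)//; apply: lime_le; last exact: nearW.
by apply/cvg_ex; eexists; exact: cv.
Qed.

End integration_facts.

(** * The Fejer kernel *)

Section fejer_kernel.
Context {R : realType}.
Local Notation mu := (@lebesgue_measure R).
Implicit Types r s t v w : R.

Lemma Rintegral_cos t v w : t != 0 -> v <= w ->
  \int[mu]_(r in `[v, w]) cos (t * r) = (sin (t * w) - sin (t * v)) / t.
Proof.
move=> t0 vw.
have dF (x : R) : is_derive x 1 (fun r => sin (t * r) / t) (cos (t * x)).
  by apply: is_derive_eq; rewrite !scaler1 /GRing.scale/=; field.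
rewrite (Rintegral_FTC vw dF) ?mulrBl// => x.
apply: continuous_comp; last exact: continuous_cos.
exact: mulrl_continuous.
Qed.

(** Cosine transform of the triangle [1 - t], that is [(1 - cos s) / s^2], left unnormalised with
    total mass pi. In this form the bounded frequency range is built in, and means of [fejer]
    against a law become integrals of its characteristic function by Fubini. *)
Definition fejer s := \int[mu]_(t in `[0, 1]) ((1 - t) * cos (t * s)).

Lemma continuous_fejer_integrand s : continuous (fun t => (1 - t) * cos (t * s)).
Proof.
move=> x; apply: cvgM; first by apply: cvgB; [exact: cvg_cst|exact: cvg_id].
apply: continuous_comp; last exact: continuous_cos.
exact: mulrr_continuous.
Qed.

Lemma fejerE s : s != 0 -> fejer s = (1 - cos s) / s ^+ 2.
Proof.
move=> s0.
have dF (x : R) : is_derive x 1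
    (fun t => (1 - t) * (sin (t * s) / s) - cos (t * s) / s ^+ 2)
    ((1 - x) * cos (x * s)).
  by apply: is_derive_eq; rewrite !scaler1 /GRing.scale/=; field.
rewrite /fejer (Rintegral_FTC ler01 dF); last exact: continuous_fejer_integrand.
by rewrite subrr !mul0r sub0r mul1r cos0 sin0 mul0r mulr0 sub0r mul1r; field.
Qed.

Lemma fejer0 : fejer 0 = 1 / 2.
Proof.
have dF (x : R) : is_derive x 1 (fun t => t - t ^+ 2 / 2) ((1 - x) * cos (x * 0)).
  apply: is_derive_eq.
  by rewrite mulr0 cos0 !scaler1 /GRing.scale/=; field.
rewrite /fejer (Rintegral_FTC ler01 dF); last exact: continuous_fejer_integrand.
by field.
Qed.

Lemma fejer_ge0 s : 0 <= fejer s.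
Proof.
have [->|s0] := eqVneq s 0; first by rewrite fejer0.
by rewrite fejerE// divr_ge0 ?sqr_ge0// subr_ge0 cos_le1.
Qed.

Lemma fejer_le1 s : fejer s <= 1.
Proof.
have [->|s0] := eqVneq s 0; first by rewrite fejer0; lra.
by rewrite fejerE// ler_pdivrMr ?mul1r ?onem_cos_le_sqr ?exprn_even_gt0.
Qed.

Lemma fejer_ge s : `|s| <= 1 -> 1 / 8 <= fejer s.
Proof.
have [->|s0] := eqVneq s 0; first by rewrite fejer0; lra.
move=> s1; rewrite fejerE// ler_pdivlMr ?exprn_even_gt0//.
by have := sqr_le_onem_cos s1; lra.
Qed.

Lemma fejer_le_sqrV s : s != 0 -> fejer s <= 2 / s ^+ 2.
Proof.
move=> s0; rewrite fejerE// ler_pM2r ?invr_gt0 ?exprn_even_gt0//.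
by have := cos_geN1 s; lra.
Qed.

Lemma fejerN s : fejer (- s) = fejer s.
Proof. by rewrite /fejer; under eq_Rintegral do rewrite mulrN cosN. Qed.

Lemma measurable_fejer : measurable_fun setT fejer.
Proof.
(* At 0 the first term vanishes because [1 - cos 0 = 0], and the indicator supplies the value
   1/2. *)
have -> : fejer = (fun s => (1 - cos s) * (s ^+ 2) `^ (-1) + 2^-1 * \1_[set 0] s).
  apply/funext => s; have [->|s0] := eqVneq s 0.
    by rewrite fejer0 cos0 subrr mul0r add0r indicE mem_set ?mulr1 ?mul1r.
  rewrite fejerE// powRN powRr1 ?sqr_ge0// indicE memNset ?mulr0 ?addr0//.
  exact/eqP.
apply: measurable_funD; apply: measurable_funM => //.
- by apply: measurable_funB => //; exact: measurable_cos.
- apply: (measurableT_comp (measurable_powR _)); exact: exprn_measurable.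
Qed.

(** The right-hand interval omits 0, where the quotient is 0 by convention instead of its limit
    [w - v]. *)
Lemma Rintegral_fejer v w : v <= w -> \int[mu]_(r in `[v, w]) fejer r =
  \int[mu]_(t in `]0, 1]) ((1 - t) * ((sin (t * w) - sin (t * v)) / t)).
Proof.
move=> vw; rewrite /fejer.
have mf : measurable_fun (setT : set (R * R))
    (fun z => (1 - z.2) * cos (z.2 * z.1)).
  apply: measurable_funM; first exact: measurable_funB.
  by apply: (measurableT_comp measurable_cos); exact: measurable_funM.
rewrite (@Rintegral_fubini_bounded _ _ _ _ _ mu mu `[v, w] `[0, 1]
  (fun r t => (1 - t) * cos (t * r)) 1)//=.
- transitivity (\int[mu]_(t in `[0, 1])
      ((1 - t) * \int[mu]_(r in `[v, w]) cos (t * r))).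
    apply: eq_Rintegral => t _; rewrite RintegralZl//.
    apply: continuous_itv_integrable => x.
    apply: continuous_comp; last exact: continuous_cos.
    exact: mulrl_continuous.
  have E : {in `]0, 1]%classic, forall t,
      (1 - t) * ((sin (t * w) - sin (t * v)) / t) =
      (1 - t) * \int[mu]_(r in `[v, w]) cos (t * r)}.
    move=> t /set_mem; rewrite /= in_itv/= => /andP[t0 _].
    by rewrite Rintegral_cos// gt_eqF.
  rewrite /Rintegral -integral_itv_obnd_cbnd -/(Rintegral _ _ _).
    by apply: eq_Rintegral => t t01; rewrite E.
  apply/measurable_EFinP; apply: eq_measurable_fun E _.
  apply: measurable_funTS; apply: measurable_funM; first exact: measurable_funB.
  apply: measurable_funM; last exact: measurable_funV.
  by apply: measurable_funB; apply: (measurableT_comp measurable_sin);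
    exact: measurable_funM.
- by rewrite lebesgue_measure_itv/= lte_fin; case: ifP => // _; rewrite -EFinB ltry.
- by rewrite lebesgue_measure_itv/= lte_fin; case: ifP => // _; rewrite -EFinB ltry.
- exact: measurable_funTS.
- move=> x y _; rewrite /= in_itv/= => /andP[y0 y1]; rewrite normrM.
  by rewrite mulr_ile1// ?cos_max// ger0_norm; lra.
Qed.

Lemma integral_sqrV_itvcy (h : R) : 0 < h ->
  (\int[mu]_(r in `[h, +oo[) (2 / r ^+ 2)%:E = (2 / h)%:E)%E.
Proof.
move=> h0.
have dF (x : R) : 0 < x -> is_derive x 1 (fun x => - (2 / x)) (2 / x ^+ 2).
  move=> /gt_eqF/negbT x0.
  apply: (is_derive_eq (is_deriveN (is_deriveM (is_derive_cst (2:R) x 1)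
    (is_deriveV x0 (is_derive_id x 1))))).
  by rewrite !scaler1 scaler0 addr0 /GRing.scale/=; field.
rewrite (@ge0_continuous_FTC2y _ (fun r => 2 / r ^+ 2) (fun r => - (2 / r)) h 0).
- by rewrite sub0e -EFinN opprK.
- by move=> x hx; rewrite divr_ge0 ?sqr_ge0.
- apply: continuous_in_subspaceT => x /set_mem; rewrite /= in_itv/= andbT => hx.
  have x0 := lt_le_trans h0 hx.
  apply: cvgM; first exact: cvg_cst.
  apply: cvgV; first by rewrite expf_neq0// gt_eqF.
  exact: exprn_continuous.
- rewrite -oppr0; apply: cvgN; rewrite -(mulr0 2); apply: cvgM; first exact: cvg_cst.
  apply/gtr0_cvgV0; last exact: cvg_id.
  exact: nbhs_pinfty_gt.
- by move=> x hx; have [] := dF _ (lt_trans h0 hx).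
- apply: cvg_at_right_filter.
  by case: (dF _ h0) => /derivable1_diffP/differentiable_continuous + _; apply.
- move=> x; rewrite in_itv/= andbT => hx.
  by rewrite derive1E; have [] := dF _ (lt_trans h0 hx).
Qed.

Lemma tail_fejer (h : R) : 0 < h ->
  (\int[mu]_(r in ~` `[(- h)%R, h]) (fejer r)%:E <= (4 / h)%:E)%E.
Proof.
move=> h0.
have mfE D : measurable_fun D (EFin \o fejer).
  by apply/measurable_funTS/measurable_EFinP; exact: measurable_fejer.
have mg (D : set R) : measurable_fun D (fun r : R => (2 / r ^+ 2)%:E).
  apply/measurable_EFinP; apply: measurable_funM => //.
  by apply: measurable_funV; apply: measurable_funX.
have right : (\int[mu]_(r in `]h, +oo[) (fejer r)%:E <= (2 / h)%:E)%E.
  rewrite -integral_sqrV_itvcy//.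
  apply: (@le_trans _ _ (\int[mu]_(r in `]h, +oo[) (2 / r ^+ 2)%:E)%E).
    apply: ge0_le_integral => //.
    - by move=> x _; rewrite lee_fin fejer_ge0.
    - exact: mfE.
    - exact: mg.
    - move=> x; rewrite /= in_itv/= andbT => hx.
      by rewrite lee_fin fejer_le_sqrV// gt_eqF// (lt_trans h0).
  rewrite integral_itv_obnd_cbnd//.
have -> : ~` `[- h, h] = `]-oo, (- h)[ `|` `]h, +oo[ :> set R.
  apply/seteqP; split=> x /=; rewrite !in_itv/= andbT.
    by move=> /negP; rewrite negb_and -!ltNge => /orP.
  by move=> [xh|hx] /andP[]; rewrite leNgt ?xh// [x <= h]leNgt hx.
rewrite ge0_integral_setU//=.
- rewrite (_ : 4 / h = 2 / h + 2 / h); last by field; rewrite gt_eqF.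
  rewrite EFinD; apply: leeD; last exact: right.
  rewrite ge0_integral_oppr; [|by []|exact: mfE|]; last first.
    by move=> x _; rewrite lee_fin fejer_ge0.
  rewrite (_ : _ @^-1` _ = `]h, +oo[%classic); last first.
    by apply/seteqP; split=> x /=; rewrite !in_itv/= ltrN2 ?andbT.
  by under eq_integral do rewrite fejerN.
- exact: mfE.
- by move=> x _; rewrite lee_fin fejer_ge0.
- rewrite disj_set2E; apply/eqP/seteqP; split => // x /=; rewrite !in_itv/= andbT.
  by move=> [xh hx]; lra.
Qed.

End fejer_kernel.

(** * Smoothing inequality *)

Section fejer_means.
Context {R : realType} {d} {T : measurableType d} (P : probability T R).
Local Notation mu := (@lebesgue_measure R).
Implicit Types (x z t r L : R).

Lemma integrable_probability_bounded (f : T -> R) (C : R) :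
  measurable_fun setT f -> (forall w, `|f w| <= C) ->
  P.-integrable setT (EFin \o f).
Proof.
move=> mf fC; apply: (@integrable_bounded _ _ _ _ _ _ C) => //.
by rewrite (le_lt_trans (probability_le1 _ measurableT))// ltry.
Qed.

Lemma le_normr_expectation (f : T -> R) (C : R) :
  measurable_fun setT f -> (forall w, `|f w| <= C) ->
  `|\int[P]_w f w| <= C.
Proof.
move=> mf fC.
have intf := integrable_probability_bounded mf fC.
apply: (le_trans (le_normr_Rintegral measurableT intf)).
apply: (@le_trans _ _ (\int[P]_w C)).
  apply: le_Rintegral => //; first exact: integrable_norm.
  apply: (@integrable_probability_bounded (cst C) `|C|) => //.
by rewrite Rintegral_cst// [X in fine X]probability_setT mulr1.
Qed.

Lemma measurable_expectation_param (f : R -> T -> R) (C : R) :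
  measurable_fun setT (fun z : R * T => f z.1 z.2) ->
  (forall t w, `|f t w| <= C) ->
  measurable_fun setT (fun t => \int[P]_w f t w).
Proof.
move=> mf fC.
have mft t : measurable_fun setT (f t).
  have -> : f t = (fun z : R * T => f z.1 z.2) \o pair t by [].
  exact: measurableT_comp.
(* Adding [C] makes the integrand nonnegative, so that the measurability part of Tonelli's theorem
   applies. *)
have -> : (fun t => \int[P]_w f t w) =
    (fun t => fine (\int[P]_w (f t w + C)%:E)%E - C).
  apply/funext => t.
  rewrite -/(Rintegral P setT (fun w => f t w + C)) RintegralD//; last 2 first.
  - exact: integrable_probability_bounded (fC t).
  - exact: (@integrable_probability_bounded (cst C) `|C|).
  by rewrite Rintegral_cst// [X in fine X]probability_setT mulr1 addrK.
have mF : measurable_fun setT (fun t => \int[P]_w (f t w + C)%:E)%E.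
  apply: (measurable_fun_fubini_tonelli_F (m2 := P)
    (fun z : R * T => (f z.1 z.2 + C)%:E)).
    by apply/measurable_EFinP; exact: measurable_funD.
  move=> z; rewrite lee_fin -lerBlDr sub0r.
  by have := fC z.1 z.2; rewrite ler_norml => /andP[].
apply: measurable_funB => //.
by apply: (measurableT_comp _ mF); exact: fine_measurable.
Qed.

Variable X : {RV P >-> R}.

Definition cos_mean t := \int[P]_w cos (t * X w).
Definition sin_mean t := \int[P]_w sin (t * X w).

Let mX : measurable_fun setT X. Proof. exact: measurable_funPT. Qed.

Lemma measurable_cos_mean : measurable_fun setT cos_mean.
Proof.
apply: (@measurable_expectation_param (fun t w => cos (t * X w)) 1).
  apply: (measurableT_comp measurable_cos); apply: measurable_funM => //.
  exact: (measurableT_comp mX).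
by move=> t w; exact: cos_max.
Qed.

Lemma measurable_sin_mean : measurable_fun setT sin_mean.
Proof.
apply: (@measurable_expectation_param (fun t w => sin (t * X w)) 1).
  apply: (measurableT_comp measurable_sin); apply: measurable_funM => //.
  exact: (measurableT_comp mX).
by move=> t w; exact: sin_max.
Qed.

Let icos t : P.-integrable setT (EFin \o (fun w => cos (t * X w))).
Proof.
apply: (@integrable_probability_bounded _ 1) => [|w]; last exact: cos_max.
by apply: (measurableT_comp measurable_cos); exact: measurable_funM.
Qed.

Let isin t : P.-integrable setT (EFin \o (fun w => sin (t * X w))).
Proof.
apply: (@integrable_probability_bounded _ 1) => [|w]; last exact: sin_max.
by apply: (measurableT_comp measurable_sin); exact: measurable_funM.
Qed.

Lemma cos_mean_le1 t : `|cos_mean t| <= 1.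
Proof.
apply: le_normr_expectation => [|w]; last exact: cos_max.
by apply: (measurableT_comp measurable_cos); exact: measurable_funM.
Qed.

Lemma sin_mean_le1 t : `|sin_mean t| <= 1.
Proof.
apply: le_normr_expectation => [|w]; last exact: sin_max.
by apply: (measurableT_comp measurable_sin); exact: measurable_funM.
Qed.

Let icosZ c t : P.-integrable setT (EFin \o (fun w => c * cos (t * X w))).
Proof.
apply: (@integrable_probability_bounded _ `|c|) => [|w].
  apply: measurable_funM => //.
  by apply: (measurableT_comp measurable_cos); exact: measurable_funM.
by rewrite normrM -[leRHS]mulr1 ler_wpM2l// cos_max.
Qed.

Let isinZ c t : P.-integrable setT (EFin \o (fun w => c * sin (t * X w))).
Proof.
apply: (@integrable_probability_bounded _ `|c|) => [|w].
  apply: measurable_funM => //.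
  by apply: (measurableT_comp measurable_sin); exact: measurable_funM.
by rewrite normrM -[leRHS]mulr1 ler_wpM2l// sin_max.
Qed.

Lemma cos_mean_shift t x : \int[P]_w cos (t * (X w - x)) =
  cos (t * x) * cos_mean t + sin (t * x) * sin_mean t.
Proof.
rewrite -!RintegralZl// -RintegralD//.
by apply: eq_Rintegral => w _; rewrite mulrBr cosB; ring.
Qed.

Lemma sin_mean_shift t x : \int[P]_w sin (t * (x - X w)) =
  sin (t * x) * cos_mean t - cos (t * x) * sin_mean t.
Proof.
rewrite -!RintegralZl// -RintegralB//.
by apply: eq_Rintegral => w _; rewrite mulrBr sinB; ring.
Qed.

Let lty01 : (mu `[0%R, 1%R] < +oo)%E.
Proof. by rewrite lebesgue_measure_itv/= lte_fin ltr01 -EFinB ltry. Qed.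

Let lty01' : (mu `]0%R, 1%R] < +oo)%E.
Proof. by rewrite lebesgue_measure_itv/= lte_fin ltr01 -EFinB ltry. Qed.

Let Ploo : (P setT < +oo)%E.
Proof. by rewrite probability_setT ltry. Qed.

(** Only the frequencies in [[0, L]] of the law enter. *)
Lemma mean_fejer L x : \int[P]_w fejer (L * (X w - x)) =
  \int[mu]_(t in `[0, 1]) ((1 - t) *
    (cos (t * L * x) * cos_mean (t * L) + sin (t * L * x) * sin_mean (t * L))).
Proof.
rewrite (@Rintegral_fubini_bounded _ _ _ _ _ P mu setT `[0, 1]
  (fun w t => (1 - t) * cos (t * (L * (X w - x)))) 1)//.
- apply: eq_Rintegral => t _; rewrite -cos_mean_shift -RintegralZl//.
    by apply: eq_Rintegral => w _; rewrite mulrA.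
  apply: (@integrable_probability_bounded _ 1) => [|w]; last exact: cos_max.
  apply: (measurableT_comp measurable_cos); apply: measurable_funM => //.
  exact: measurable_funB.
- apply: measurable_funTS; apply: measurable_funM; first exact: measurable_funB.
  apply: (measurableT_comp measurable_cos); apply: measurable_funM => //.
  apply: measurable_funM => //; apply: measurable_funB => //.
  exact: (measurableT_comp mX).
- move=> w t _; rewrite /= in_itv/= => /andP[t0 t1]; rewrite normrM.
  by rewrite mulr_ile1// ?cos_max// ger0_norm; lra.
Qed.

(** The kernel at scale [h] is at least 1/8 on the interval, so the probability is at most 8 times
    its mean; that mean is at most the integral of [2 B e^(- k t / h)] over [[0, 1]], hence at most
    [2 B h / k]. *)
Lemma concentration (B k h x : R) : 0 < h -> 0 < k ->
  (forall t, 0 <= t -> `|cos_mean t| <= B * expR (- (k * t))) ->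
  (forall t, 0 <= t -> `|sin_mean t| <= B * expR (- (k * t))) ->
  fine (P (X @^-1` `[x - h, x + h])) <= 16 * (B / k) * h.
Proof.
move=> h0 k0 Bc Bs; set A := X @^-1` _.
have B0 : 0 <= B.
  by have := Bc 0 (lexx _); rewrite mulr0 oppr0 expR0 mulr1; apply: le_trans.
have mA : measurable A by rewrite -[A]setTI; exact: mX.
have mf : measurable_fun setT (fun w => fejer (h^-1 * (X w - x))).
  apply: (measurableT_comp measurable_fejer); apply: measurable_funM => //.
  exact: measurable_funB.
have intf : P.-integrable setT (EFin \o (fun w => fejer (h^-1 * (X w - x)))).
  apply: (@integrable_probability_bounded _ 1) => // w.
  by rewrite ger0_norm ?fejer_ge0 ?fejer_le1.
have -> : fine (P A) = \int[P]_w \1_A w.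
  by rewrite /Rintegral integral_indic// setIT.
have h1 : \int[P]_w (1 / 8 * \1_A w) <= \int[P]_w fejer (h^-1 * (X w - x)).
  apply: le_Rintegral => //.
    apply: (@integrable_probability_bounded _ 1).
      by apply: measurable_funM.
    move=> w; rewrite indicE.
    by case: (w \in A); rewrite ?mulr1 ?mulr0 ger0_norm; lra.
  move=> w _; rewrite indicE; case: (boolP (w \in A)) => [/set_mem|_]; last first.
    by rewrite mulr0 fejer_ge0.
  rewrite /A/= in_itv/= => /andP[xh hx]; rewrite mulr1 fejer_ge//.
  rewrite normrM [`|h^-1|]gtr0_norm ?invr_gt0// mulrC ler_pdivrMr// mul1r.
  by rewrite ler_norml; apply/andP; split; lra.
rewrite RintegralZl// in h1; last first.
  apply: (@integrable_probability_bounded _ 1) => // w.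
  by rewrite indicE; case: (w \in A); rewrite ?normr1 ?normr0.
suff : \int[P]_w fejer (h^-1 * (X w - x)) <= 2 * (B / k) * h by lra.
rewrite mean_fejer; pose c := k / h.
have c0 : 0 < c by rewrite divr_gt0.
have dF (t : R) : is_derive t 1 (fun t => - (2 * B / c) * expR (- (c * t)))
    (2 * B * expR (- (c * t))).
  apply: is_derive_eq; rewrite !scaler1 /GRing.scale/=; field.
  by rewrite gt_eqF.
have cf : continuous (fun t => 2 * B * expR (- (c * t))).
  move=> t; apply: cvgM; first exact: cvg_cst.
  apply: continuous_comp; last exact: continuous_expR.
  by apply: cvgN; exact: mulrl_continuous.
apply: (@le_trans _ _ (\int[mu]_(t in `[0, 1]) (2 * B * expR (- (c * t))))).
  apply: le_Rintegral => //.
  - apply: (@integrable_bounded _ _ _ _ _ _ 2) => //.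
      apply: measurable_funTS; apply: measurable_funM; first exact: measurable_funB.
      have mth : measurable_fun setT (fun t : R => t / h) by exact: measurable_funM.
      apply: measurable_funD; apply: measurable_funM.
      + by apply: (measurableT_comp measurable_cos); exact: measurable_funM.
      + exact: (measurableT_comp measurable_cos_mean).
      + by apply: (measurableT_comp measurable_sin); exact: measurable_funM.
      + exact: (measurableT_comp measurable_sin_mean).
    move=> t; rewrite /= in_itv/= => /andP[t0 t1].
    rewrite normrM -[leRHS]mul1r ler_pM//; first by rewrite ger0_norm; lra.
    rewrite (le_trans (ler_normD _ _))// -[leRHS]/(1 + 1) !normrM.
    apply: lerD; apply: mulr_ile1;
      rewrite ?cos_max ?sin_max ?cos_mean_le1 ?sin_mean_le1//.
  - exact: continuous_itv_integrable.
  move=> t; rewrite /= in_itv/= => /andP[t0 t1].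
  have th0 : 0 <= t / h by rewrite divr_ge0// ltW.
  have := Bc _ th0; have := Bs _ th0.
  rewrite (_ : k * (t / h) = c * t); last by rewrite /c; field; rewrite gt_eqF.
  set e := B * _ => se ce.
  have -> : 2 * B * expR (- (c * t)) = e + e by rewrite /e; ring.
  apply: (le_trans (ler_norm _)); rewrite normrM -[leRHS]mul1r.
  apply: ler_pM => //; first by rewrite ger0_norm; lra.
  apply: (le_trans (ler_normD _ _)); rewrite !normrM.
  apply: lerD; rewrite -[leRHS]mul1r; apply: ler_pM => //.
    exact: cos_max.
  exact: sin_max.
rewrite (Rintegral_FTC ler01 dF cf) mulr0 oppr0 expR0.
rewrite (_ : 2 * (B / k) * h = 2 * B / c); last first.
  by rewrite /c; field; rewrite !gt_eqF.
have : 0 <= 2 * B / c * expR (- (c * 1)).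
  by rewrite mulr_ge0 ?expR_ge0// divr_ge0 ?(ltW c0)// mulr_ge0.
lra.
Qed.

Lemma cdfB x z : z <= x ->
  fine (cdf X x) - fine (cdf X z) = fine (P (X @^-1` `]z, x])).
Proof.
move=> zx.
have m1 : measurable (X @^-1` `]-oo, z]) by rewrite -[_ @^-1` _]setTI; exact: mX.
have m2 : measurable (X @^-1` `]z, x]) by rewrite -[_ @^-1` _]setTI; exact: mX.
apply/eqP; rewrite subr_eq addrC -fineD ?fin_num_measure//.
rewrite /cdf /distribution /pushforward/= -measureU//.
  rewrite -preimage_setU; apply/eqP; congr (fine (P (_ @^-1` _))).
  by rewrite -itv_bndbnd_setU.
apply/seteqP; split => // w /=; rewrite !in_itv/= => -[].
by rewrite leNgt => /negP h1 /andP[/h1].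
Qed.

Lemma cdf_lipschitz (B k x y : R) : 0 < k -> x <= y ->
  (forall t, 0 <= t -> `|cos_mean t| <= B * expR (- (k * t))) ->
  (forall t, 0 <= t -> `|sin_mean t| <= B * expR (- (k * t))) ->
  fine (cdf X y) - fine (cdf X x) <= 8 * (B / k) * (y - x).
Proof.
rewrite le_eqVlt => k0 /predU1P[->|xy] Bc Bs; first by rewrite !subrr mulr0.
rewrite (cdfB (ltW xy)); pose h := (y - x) / 2.
have h0 : 0 < h by rewrite divr_gt0// subr_gt0.
rewrite (_ : 8 * _ * _ = 16 * (B / k) * h); last first.
  by rewrite /h; field; rewrite gt_eqF.
apply: (le_trans _ (concentration ((x + y) / 2) h0 k0 Bc Bs)).
have mI (i : interval R) : measurable (X @^-1` [set` i]).
  by rewrite -[_ @^-1` _]setTI; exact: mX.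
rewrite fine_le ?fin_num_measure// le_measure ?inE//.
by move=> w /=; rewrite !in_itv/= /h => /andP[? ?]; apply/andP; split; lra.
Qed.

(** Parseval formula for the smoothed mass of the interval from [z] to [x]. The factor [1 / t] comes
    from integrating the kernel, and is harmless since the difference of sines vanishes at
    [t = 0]. *)
Lemma mean_Rintegral_fejer (L x z : R) : 0 <= L -> z <= x ->
  \int[P]_w (\int[mu]_(r in `[L * (z - X w), L * (x - X w)]) fejer r) =
  \int[mu]_(t in `]0, 1]) ((1 - t) *
    (((sin (t * L * x) - sin (t * L * z)) * cos_mean (t * L) -
      (cos (t * L * x) - cos (t * L * z)) * sin_mean (t * L)) / t)).
Proof.
move=> L0 zx.
pose s t w := (sin (t * (L * (x - X w))) - sin (t * (L * (z - X w)))) / t.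
have ms : measurable_fun (setT : set (R * T)) (fun u => s u.1 u.2).
  apply: measurable_funM; last exact: measurable_funV.
  apply: measurable_funB; apply: (measurableT_comp measurable_sin);
    apply: measurable_funM => //; apply: measurable_funM => //;
    apply: measurable_funB => //; exact: (measurableT_comp mX).
(* The Lipschitz bound on the sine keeps the quotient by [t] bounded, which is what Fubini needs. *)
have sb t w : `|s t w| <= L * (x - z).
  have [->|t0] := eqVneq t 0.
    by rewrite /s invr0 mulr0 normr0 mulr_ge0// subr_ge0.
  rewrite /s normrM normfV ler_pdivrMr ?normr_gt0//.
  apply: (le_trans (sin_lipschitz _ _)); rewrite -mulrBr normrM mulrC.
  rewrite -mulrBr ler_wpM2r// ger0_norm; last first.
    by rewrite mulr_ge0//; lra.
  by rewrite ler_wpM2l//; lra.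
transitivity (\int[P]_w \int[mu]_(t in `]0, 1]) ((1 - t) * s t w)).
  apply: eq_Rintegral => w _; rewrite Rintegral_fejer// ler_wpM2l//; lra.
rewrite (@Rintegral_fubini_bounded _ _ _ _ _ P mu setT `]0, 1]
  (fun w t => (1 - t) * s t w) (L * (x - z)))//.
- apply: eq_Rintegral => t _; rewrite RintegralZl//; last first.
    apply: (integrable_probability_bounded _ (sb t)).
    have -> : s t = (fun u : R * T => s u.1 u.2) \o pair t by [].
    exact: measurableT_comp.
  congr (_ * _).
  under eq_Rintegral do rewrite /s.
  have i1 y : P.-integrable setT (EFin \o (fun w => sin (t * L * (y - X w)))).
    apply: (@integrable_probability_bounded _ 1) => [|w]; last exact: sin_max.
    apply: (measurableT_comp measurable_sin); apply: measurable_funM => //.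
    exact: measurable_funB.
  under eq_Rintegral do rewrite !mulrA.
  rewrite RintegralZr//; last first.
    exact: (integrableB measurableT (i1 x) (i1 z)).
  by rewrite RintegralB// !sin_mean_shift; congr (_ / _); ring.
- apply: measurable_funTS; apply: measurable_funM; first exact: measurable_funB.
  exact: (measurableT_comp ms (measurable_fun_pair measurable_snd measurable_fst)).
- move=> w t _; rewrite /= in_itv/= => /andP[t0 t1]; rewrite normrM -[leRHS]mul1r.
  by rewrite ler_pM// ger0_norm; lra.
Qed.

End fejer_means.

(** * Averages against the Fejer kernel *)

Section smoothing_inequality.
Context {R : realType}.
Local Notation mu := (@lebesgue_measure R).

Lemma integrable_fejer : mu.-integrable setT (EFin \o fejer).
Proof.
apply/integrableP; split.
  by apply/measurable_EFinP; exact: measurable_fejer.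
have mf : measurable_fun setT (fun x : R => `|(EFin \o fejer) x|%E).
  by apply: measurableT_comp => //; apply/measurable_EFinP; exact: measurable_fejer.
have mI : measurable (`[-1, 1] : set R) by [].
rewrite -(setUv (`[-1, 1] : set R)) ge0_integral_setU//=; last 3 first.
- exact: measurableC.
- exact: measurable_funTS.
- by apply/disj_setPCl.
rewrite lte_add_pinfty//.
  have Ioo : (mu `[(-1)%R, 1%R] < +oo)%E.
    rewrite lebesgue_measure_itv/= lte_fin.
    by case: ifP => // _; rewrite -EFinB ltry.
  have /integrableP[] // : mu.-integrable `[-1, 1] (EFin \o fejer).
  apply: (@integrable_bounded _ _ _ _ _ _ 1) => //.
    by apply: measurable_funTS; exact: measurable_fejer.
  by move=> x _; rewrite ger0_norm ?fejer_ge0 ?fejer_le1.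
  
under eq_integral do rewrite ger0_norm ?fejer_ge0//.
by rewrite (le_lt_trans (tail_fejer ltr01))// ltry.
Qed.

Lemma integrable_fejerM (E : R -> R) (C : R) : measurable_fun setT E ->
  (forall r, `|E r| <= C) ->
  mu.-integrable setT (EFin \o (fun r => fejer r * E r)).
Proof.
move=> mE EC.
apply: (@le_integrable _ _ _ mu setT measurableT _ (EFin \o (fun r => C * fejer r))).
- apply/measurable_EFinP; apply: measurable_funM => //; exact: measurable_fejer.
- move=> r _ /=; rewrite lee_fin !normrM mulrC ler_wpM2r//.
  exact: le_trans (EC r) (ler_norm _).
- exact: (integrableZl measurableT C integrable_fejer).
Qed.

(* The window [-512, 512] carries mass at least 1/4 of the kernel, its
   complement at most 1/128. *)
Lemma fejer_smoothing_ge (E : R -> R) (q : R) : 0 <= q ->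
  measurable_fun setT E ->
  (forall r, `|E r| <= 4 * q) -> (forall r, `|r| <= 512 -> 3 / 8 * q <= E r) ->
  q / 16 <= \int[mu]_r (fejer r * E r).
Proof.
move=> q0 mE Eq4 Eq.
(* Window: [(1/4) (3/8) q = 3 q / 32]. Complement: at least [- (1/128) 4 q = - q / 32]. *)
have q16 : q / 16 <= 3 / 32 * q + - (1 / 32 * q) by lra.
pose W : set R := `[-512, 512]%classic.
have mW : measurable W by exact: measurable_itv.
have iE := integrable_fejerM mE Eq4.
have Woo : (mu W < +oo)%E.
  by rewrite lebesgue_measure_itv/= lte_fin; case: ifP => // _; rewrite -EFinB ltry.
have mu11 : mu `[(-1)%R, 1%R] = 2%:E.
  rewrite lebesgue_measure_itv/= lte_fin ifT ?ltrN1// -EFinB opprK//; lra.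
have i8 : mu.-integrable W (EFin \o (fun r => 1 / 8 * \1_(`[-1, 1] : set R) r)).
  apply: (@integrable_bounded _ _ _ _ _ _ 1) => //.
    by apply: measurable_funM => //; exact: measurable_indic.
  move=> r _; rewrite indicE.
  by case: (r \in _); rewrite ?mulr1 ?mulr0 ger0_norm//; lra.
have iM (c : R) (D : set R) : measurable D ->
    mu.-integrable D (EFin \o (fun r => fejer r * c)).
  move=> mD; apply: (@integrableS _ _ _ _ setT) => //.
  by apply: (@integrable_fejerM (cst c) `|c|) => //.
have iW : mu.-integrable W (EFin \o fejer).
  exact: integrableS integrable_fejer.
have iWC : mu.-integrable (~` W) (EFin \o fejer).
  by apply: integrableS integrable_fejer => //; exact: measurableC.
rewrite -(setUv W) Rintegral_setU//; last 3 first.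
- exact: measurableC.
- by rewrite setUv.
- exact/disj_setPCl.
have h1 : 3 / 32 * q <= \int[mu]_(r in W) (fejer r * E r).
  apply: (@le_trans _ _ (\int[mu]_(r in W) (fejer r * (3 / 8 * q)))).
    rewrite RintegralZr//.
    have : 1 / 4 <= \int[mu]_(r in W) fejer r.
      apply: (@le_trans _ _ (\int[mu]_(r in W) (1 / 8 * \1_(`[-1, 1] : set R) r))).
        rewrite RintegralZl//; last first.
          apply: (@integrable_bounded _ _ _ _ _ _ 1) => //.
          by move=> r _; rewrite indicE; case: (r \in _); rewrite ?normr1 ?normr0.
        rewrite /Rintegral integral_indic// setIidl; last first.
          move=> r; rewrite /W/= !in_itv/= => /andP[? ?]; apply/andP; split; lra.
        by rewrite [X in fine X]mu11/=; lra.
      apply: le_Rintegral => //.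
      move=> r _; rewrite indicE; case: (boolP (r \in _)) => [/set_mem|_].
        by rewrite /= in_itv/= mulr1 -ler_norml => /fejer_ge.
      by rewrite mulr0 fejer_ge0.
    by nra.
  apply: le_Rintegral => //.
  - exact: iM.
  - exact: integrableS iE.
  - move=> r; rewrite /W/= in_itv/= -ler_norml => r512.
    by rewrite ler_wpM2l ?fejer_ge0// Eq.
have h2 : - (1 / 32 * q) <= \int[mu]_(r in ~` W) (fejer r * E r).
  apply: (@le_trans _ _ (\int[mu]_(r in ~` W) (fejer r * (- (4 * q))))).
    rewrite RintegralZr//; last exact: measurableC.
    have : \int[mu]_(r in ~` W) fejer r <= 1 / 128.
      rewrite -lee_fin /Rintegral fineK; last first.
        by apply: integrable_fin_num => //; exact: measurableC.
      have := @tail_fejer R 512 ltac:(lra); congr (_ <= _)%E.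
      by congr EFin; lra.
    by nra.
  apply: le_Rintegral; first exact: measurableC.
  - by apply: iM; exact: measurableC.
  - by apply: integrableS iE => //; exact: measurableC.
  - move=> r _; rewrite ler_wpM2l ?fejer_ge0//.
    by have := Eq4 r; rewrite ler_norml => /andP[].
exact: le_trans q16 (lerD h1 h2).
Qed.

Section cdf_convolution.
Context d (T : measurableType d) (P : probability T R) (X : {RV P >-> R}).

(** Both sides integrate the kernel over the set of [(r, w)] with [z < X w + r / L <= x], in the two
    orders; Tonelli suffices, the integrand being nonnegative. *)
Lemma fejer_cdf_convolution (L x z : R) : 0 < L -> z <= x ->
  \int[mu]_r (fejer r *
    (fine (cdf X (x - r / L)) - fine (cdf X (z - r / L)))) =
  \int[P]_w (\int[mu]_(r in `[L * (z - X w), L * (x - X w)]) fejer r).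
Proof.
move=> L0 zx; rewrite [LHS]/Rintegral [RHS]/Rintegral; congr fine.
have mX : measurable_fun setT X by exact: measurable_funPT.
pose B : set (R * T) := (fun u => X u.2 + u.1 / L) @^-1` `]z, x]%classic.
have mB : measurable B.
  rewrite -[B]setTI; apply: (measurable_funD _ _ measurableT) => //.
    exact: (measurableT_comp mX measurable_snd).
  exact: measurable_funM.
pose f (u : R * T) := (fejer u.1 * \1_B u)%:E.
have mf : measurable_fun setT f.
  apply/measurable_EFinP; apply: measurable_funM.
    exact: (measurableT_comp measurable_fejer).
  by apply: measurable_indic; exact: mB.
have f0 u : (0 <= f u)%E by rewrite lee_fin mulr_ge0 ?fejer_ge0.
transitivity (\int[mu]_r \int[P]_w f (r, w))%E.
  apply: eq_integral => r _.
  rewrite cdfB; last by lra.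
  pose A := X @^-1` `]z - r / L, x - r / L]%classic.
  have mA : measurable A by rewrite -[A]setTI; exact: mX.
  transitivity (\int[P]_w ((fejer r)%:E * (\1_A w)%:E))%E; last first.
    apply: eq_integral => w _; rewrite /f /= EFinM; congr (_ * _%:E)%E.
    rewrite !indicE; congr (_%:R); congr nat_of_bool.
    by apply/idP/idP => /set_mem h; apply/mem_set; move: h;
      rewrite /A/B/= !in_itv/= ltrBlDr lerBrDr.
  rewrite ge0_integralZl//; last 2 first.
  - by apply/measurable_EFinP; exact: measurable_indic.
  - by rewrite lee_fin fejer_ge0.
  rewrite integral_indic// setIT EFinM; congr (_ * _)%E.
  by rewrite fineK// fin_num_measure.
apply: (etrans (fubini_tonelli (m1 := lebesgue_measure) (m2 := P) f mf f0)).
apply: eq_integral => w _.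
rewrite /Rintegral fineK; last first.
  apply: integrable_fin_num => //.
  exact: integrableS integrable_fejer.
rewrite -integral_itv_obnd_cbnd; last first.
  by apply/measurable_EFinP/measurable_funTS; exact: measurable_fejer.
rewrite [RHS]integral_mkcond; apply: eq_integral => r _.
rewrite /f patchE indicE.
have E : ((r, w) \in B) = (r \in `]L * (z - X w), L * (x - X w)]%classic).
  apply/idP/idP => /set_mem h; apply/mem_set; move: h;
  rewrite /B/= !in_itv/= => /andP[h1 h2]; apply/andP; split.
  - by rewrite mulrC -ltr_pdivlMr//; lra.
  - by rewrite mulrC -ler_pdivrMr//; lra.
  - by move: h1; rewrite mulrC -ltr_pdivlMr//; lra.
  - by move: h2; rewrite mulrC -ler_pdivrMr//; lra.
by rewrite E; case: ifPn => _; rewrite ?mulr1 ?mulr0.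
Qed.

End cdf_convolution.

End smoothing_inequality.

(** * Esseen-type inequality *)

Section esseen.
Context {R : realType}.
Local Notation mu := (@lebesgue_measure R).
Context d (T : measurableType d) (P : probability T R) (X : {RV P >-> R}).
Context d' (T' : measurableType d') (Q : probability T' R) (Y : {RV Q >-> R}).

Let D x := fine (cdf Y x) - fine (cdf X x).

Lemma fine_cdf_itv d0 (T0 : measurableType d0) (P0 : probability T0 R)
  (Z : {RV P0 >-> R}) x : 0 <= fine (cdf Z x) <= 1.
Proof.
rewrite fine_ge0 ?cdf_ge0//= -lee_fin fineK ?cdf_le1//.
exact: fin_num_measure.
Qed.

Lemma measurable_fine_cdf d0 (T0 : measurableType d0) (P0 : probability T0 R)
  (Z : {RV P0 >-> R}) : measurable_fun setT (fine \o cdf Z).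
Proof.
by apply: measurableT_comp; [exact: fine_measurable|exact: cdf_measurable].
Qed.

(** The differences of sines and of cosines at [x] and [z] are at most 2, and the factor [t] of the
    hypotheses cancels the [1 / t] of the Parseval formula: twice [2 eps L], independently of [x]
    and [z]. *)
Lemma fejer_cdf_smoothing (L eps x z : R) : 0 < L -> 0 <= eps -> z <= x ->
  (forall t : R, 0 <= t <= L -> `|cos_mean Y t - cos_mean X t| <= eps * t) ->
  (forall t : R, 0 <= t <= L -> `|sin_mean Y t - sin_mean X t| <= eps * t) ->
  `|\int[mu]_r (fejer r * (D (x - r / L) - D (z - r / L)))| <= 4 * eps * L.
Proof.
move=> L0 eps0 zx hc hs.
have mcdf d0 (T0 : measurableType d0) (P0 : probability T0 R)
    (Z : {RV P0 >-> R}) y :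
    measurable_fun setT (fun r : R => fine (cdf Z (y - r / L))).
  apply: (measurableT_comp (measurable_fine_cdf Z)).
  by apply: measurable_funB => //; exact: measurable_funM.
have iF d0 (T0 : measurableType d0) (P0 : probability T0 R) (Z : {RV P0 >-> R}) :
    mu.-integrable setT (EFin \o (fun r => fejer r *
      (fine (cdf Z (x - r / L)) - fine (cdf Z (z - r / L))))).
  apply: (@integrable_fejerM _ _ 1); first exact: measurable_funB.
  move=> r; have := fine_cdf_itv Z (x - r / L); have := fine_cdf_itv Z (z - r / L).
  by rewrite ler_norml => /andP[? ?] /andP[? ?]; apply/andP; split; lra.
have -> : \int[mu]_r (fejer r * (D (x - r / L) - D (z - r / L))) =
    \int[mu]_r (fejer r *
      (fine (cdf Y (x - r / L)) - fine (cdf Y (z - r / L))) -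
    fejer r * (fine (cdf X (x - r / L)) - fine (cdf X (z - r / L)))).
  by apply: eq_Rintegral => r _; rewrite /D; ring.
rewrite RintegralB// !fejer_cdf_convolution// !mean_Rintegral_fejer ?(ltW L0)//.
have mu01 : mu `]0%R, 1%R] = 1%:E.
  by rewrite lebesgue_measure_itv/= lte_fin ltr01 -EFinB subr0.
have i01 (f : R -> R) (C : R) : measurable_fun setT f ->
    (forall t, 0 < t <= 1 -> `|f t| <= C) -> mu.-integrable `]0, 1] (EFin \o f).
  move=> mf fC; apply: (@integrable_bounded _ _ _ _ _ _ C) => //.
  - by rewrite [ltLHS]mu01 ltry.
  - exact: measurable_funTS.
pose J d0 (T0 : measurableType d0) (P0 : probability T0 R) (Z : {RV P0 >-> R})
    (t : R) := (1 - t) *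
      (((sin (t * L * x) - sin (t * L * z)) * cos_mean Z (t * L) -
        (cos (t * L * x) - cos (t * L * z)) * sin_mean Z (t * L)) / t).
have mB d0 (T0 : measurableType d0) (P0 : probability T0 R) (Z : {RV P0 >-> R}) :
    measurable_fun setT (J _ _ _ Z).
  have mtL : measurable_fun setT (fun t : R => t * L) by exact: measurable_funM.
  apply: measurable_funM; first exact: measurable_funB.
  apply: measurable_funM; last exact: measurable_funV.
  apply: measurable_funB; apply: measurable_funM.
  - by apply: measurable_funB; apply: (measurableT_comp measurable_sin);
      exact: measurable_funM.
  - exact: (measurableT_comp (measurable_cos_mean Z)).
  - by apply: measurable_funB; apply: (measurableT_comp measurable_cos);
      exact: measurable_funM.
  - exact: (measurableT_comp (measurable_sin_mean Z)).
have iB d0 (T0 : measurableType d0) (P0 : probability T0 R) (Z : {RV P0 >-> R}) :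
    mu.-integrable `]0, 1] (EFin \o J _ _ _ Z).
  (* This bound grows with [x - z] and serves integrability only. *)
  apply: (@i01 _ (2 * (L * (x - z)))); first exact: mB.
  move=> t /andP[t0 t1]; rewrite normrM -[leRHS]mul1r.
  apply: ler_pM => //; first by rewrite ger0_norm; lra.
  rewrite normrM normfV [`|t|]gtr0_norm// ler_pdivrMr//.
  apply: (le_trans (ler_normB _ _)); rewrite !normrM.
  have c1 : `|cos_mean Z (t * L)| <= 1 by exact: cos_mean_le1.
  have s1 : `|sin_mean Z (t * L)| <= 1 by exact: sin_mean_le1.
  have c2 := cos_lipschitz (t * L * x) (t * L * z).
  have s2 := sin_lipschitz (t * L * x) (t * L * z).
  have E : `|t * L * x - t * L * z| = L * (x - z) * t.
    rewrite -mulrBr ger0_norm; first by ring.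
    by rewrite !mulr_ge0 ?(ltW t0) ?(ltW L0)//; lra.
  rewrite E in c2 s2.
  rewrite (_ : 2 * _ * t = L * (x - z) * t + L * (x - z) * t); last by ring.
  by apply: lerD; rewrite -[leRHS]mulr1; apply: ler_pM.
rewrite -/(J _ _ _ Y) -/(J _ _ _ X) -RintegralB;
  [|exact: measurable_itv|exact: iB|exact: iB].
have iBB : mu.-integrable `]0, 1] (EFin \o (fun t => J _ _ _ Y t - J _ _ _ X t)).
  exact: (integrableB _ (iB _ _ _ Y) (iB _ _ _ X)).
have mI : measurable (`]0, 1]%classic : set R) by exact: measurable_itv.
have hJ : `|\int[mu]_(t in `]0, 1]) (J _ _ _ Y t - J _ _ _ X t)| <=
    \int[mu]_(t in `]0, 1]) `|J _ _ _ Y t - J _ _ _ X t|.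
  exact: le_normr_Rintegral.
apply: (le_trans hJ).
apply: (@le_trans _ _ (\int[mu]_(t in `]0, 1]) (4 * eps * L))); last first.
  by rewrite Rintegral_cst// [X in fine X]mu01 mulr1.
apply: le_Rintegral => //.
- exact: integrable_norm iBB.
- by apply: (@i01 _ `|4 * eps * L|).
move=> t; rewrite /= in_itv/= => /andP[t0 t1]; rewrite /J.
set S := sin _ - _; set K := cos _ - _.
rewrite (_ : _ - _ = (1 - t) * ((S * (cos_mean Y (t * L) - cos_mean X (t * L)) -
  K * (sin_mean Y (t * L) - sin_mean X (t * L))) / t)); last by ring.
have tL : 0 <= t * L <= L.
  by rewrite mulr_ge0 ?(ltW t0) ?(ltW L0)//= ler_piMl// ltW.
rewrite normrM -[leRHS]mul1r; apply: ler_pM => //; first by rewrite ger0_norm; lra.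
rewrite normrM normfV [`|t|]gtr0_norm// ler_pdivrMr//.
apply: (le_trans (ler_normB _ _)); rewrite !normrM.
have S2 : `|S| <= 2.
  by rewrite (le_trans (ler_normB _ _))// -[leRHS]/(1 + 1) lerD// sin_max.
have K2 : `|K| <= 2.
  by rewrite (le_trans (ler_normB _ _))// -[leRHS]/(1 + 1) lerD// cos_max.
have E : 4 * eps * L * t = 2 * (eps * (t * L)) + 2 * (eps * (t * L)) by ring.
by rewrite E; apply: lerD; apply: ler_pM => //; [exact: hc|exact: hs].
Qed.

Lemma cdfNy_small d0 (T0 : measurableType d0) (P0 : probability T0 R)
    (Z : {RV P0 >-> R}) (q : R) : 0 < q ->
  exists z0, forall z, z <= z0 -> fine (cdf Z z) <= q.
Proof.
move=> q0.
have /fine_cvgP[_ /cvgrPdist_le/(_ _ q0)[M [Mr h]]] := cvg_cdfNy0 Z.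
(* The filter at minus infinity asks for [z < M]; the shift by 1 turns [<=] into [<]. *)
exists (M - 1) => z zM.
have := h z; rewrite sub0r normrN => /(_ _)/(le_trans (ler_norm _)); apply.
by rewrite (le_lt_trans zM)// ltrBlDr ltrDl.
Qed.

(** A gap of order [q] that fills the kernel's window around [x1] gives a smoothed gap of at least
    [q / 16], against the upper bound [4 eps L]. The factor [s], taken as 1 or -1, treats both signs
    of the gap at once. *)
Lemma cdf_gap_le (L eps q s x1 : R) : 0 < L -> 0 <= eps -> 0 < q ->
  `|s| <= 1 ->
  (forall t : R, 0 <= t <= L -> `|cos_mean Y t - cos_mean X t| <= eps * t) ->
  (forall t : R, 0 <= t <= L -> `|sin_mean Y t - sin_mean X t| <= eps * t) ->
  (forall x, `|D x| <= 2 * q) ->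
  (forall r, `|r| <= 512 -> q / 2 <= s * D (x1 - r / L)) ->
  q <= 64 * eps * L.
Proof.
move=> L0 eps0 q0 s1 hc hs Dq hD.
have q8 : 0 < q / 8 by lra.
have [zX hX] := cdfNy_small X q8; have [zY hY] := cdfNy_small Y q8.
(* The whole window of half-width [512 / L] around [z] lies where both distribution functions are at
   most [q / 8]. Subtracting that from [q / 2] leaves the [3 q / 8] of the smoothing lemma; its
   [4 q] is twice the bound [2 q] on [D]. *)
pose z := Num.min x1 (Num.min zX zY - 512 / L).
have zx1 : z <= x1 by rewrite /z ge_min lexx.
have Dz r : `|r| <= 512 -> `|D (z - r / L)| <= q / 8.
  move=> r512.
  have zr : z - r / L <= Num.min zX zY.
    have : z <= Num.min zX zY - 512 / L by rewrite /z ge_min lexx orbT.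
    have : - r / L <= 512 / L.
      rewrite ler_pM2r ?invr_gt0//.
      by move: r512; rewrite ler_norml => /andP[]; lra.
    by rewrite mulNr; lra.
  have /hX hX' : z - r / L <= zX by rewrite (le_trans zr)// ge_min lexx.
  have /hY hY' : z - r / L <= zY by rewrite (le_trans zr)// ge_min lexx orbT.
  move: hX' hY'.
  have := fine_cdf_itv X (z - r / L); have := fine_cdf_itv Y (z - r / L).
  by rewrite ler_norml /D => /andP[? ?] /andP[? ?] ? ?; apply/andP; split; lra.
have := fejer_cdf_smoothing L0 eps0 zx1 hc hs; set I := \int[mu]_r _ => hI.
pose E r := s * (D (x1 - r / L) - D (z - r / L)).
have mD y : measurable_fun setT (fun r : R => D (y - r / L)).
  have my : measurable_fun setT (fun r : R => y - r / L).
    by apply: measurable_funB => //; exact: measurable_funM.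
  by apply: measurable_funB; apply: (measurableT_comp (measurable_fine_cdf _) my).
have sle y : `|s * y| <= `|y| by rewrite normrM ler_piMl.
have : q / 16 <= \int[mu]_r (fejer r * E r).
  apply: fejer_smoothing_ge.
  - exact: ltW.
  - by apply: measurable_funM => //; exact: measurable_funB.
  - move=> r; apply: (le_trans (sle _)); apply: (le_trans (ler_normB _ _)).
    by have := Dq (x1 - r / L); have := Dq (z - r / L); lra.
  - move=> r r512; rewrite /E mulrBr.
    have := hD r r512; have := le_trans (sle _) (Dz r r512).
    by rewrite ler_norml => /andP[? ?] ?; lra.
have -> : \int[mu]_r (fejer r * E r) = s * I.
  rewrite /I -RintegralZl//.
    by apply: eq_Rintegral => r _; rewrite /E mulrCA.
  apply: (@integrable_fejerM _ _ (4 * q)); first exact: measurable_funB.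
  move=> r; apply: (le_trans (ler_normB _ _)).
  by have := Dq (x1 - r / L); have := Dq (z - r / L); lra.
have := le_trans (ler_norm _) (le_trans (sle I) hI); lra.
Qed.

(* A jump of size [q] of [D] persists, up to a factor 2, on an interval of
   length [q / (2 M)] to its right (left) when the distribution function of [X]
   is [M]-Lipschitz; the smoothed [D] sees it as soon as that interval is long
   compared with the scale [1 / L] of the kernel. *)
Lemma esseen_smoothing (L eps B k : R) : 0 < L -> 0 <= eps -> 0 < B -> 0 < k ->
  (forall t : R, 0 <= t -> `|cos_mean X t| <= B * expR (- (k * t))) ->
  (forall t : R, 0 <= t -> `|sin_mean X t| <= B * expR (- (k * t))) ->
  (forall t : R, 0 <= t <= L -> `|cos_mean Y t - cos_mean X t| <= eps * t) ->
  (forall t : R, 0 <= t <= L -> `|sin_mean Y t - sin_mean X t| <= eps * t) ->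
  dK Y X <= 64 * (512 * (B / k) / L) + 128 * eps * L.
Proof.
move=> L0 eps0 B0 k0 Bc Bs hc hs; pose G := range (fun x => `|D x|).
have c0 : 0 <= 512 * (B / k) / L.
  apply: divr_ge0; last exact: ltW.
  by apply: mulr_ge0; [exact: ler0n|apply: divr_ge0; exact: ltW].
have e0 : 0 <= eps * L by exact: mulr_ge0 eps0 (ltW L0).
have [dK0|dK0] := leP (dK Y X) 0.
  by apply: (le_trans dK0); lra.
have D1 x : `|D x| <= 1.
  have := fine_cdf_itv X x; have := fine_cdf_itv Y x.
  by rewrite ler_norml /D => /andP[? ?] /andP[? ?]; apply/andP; split; lra.
have hsup : has_sup G.
  split; first by exists `|D 0|; exists 0.
  by exists 1 => _ [x _ <-]; exact: D1.
(* The supremum may not be attained: a point where [|D|] exceeds half of it is enough, and then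
   [|D| <= 2 q] everywhere. *)
have q2 : 0 < dK Y X / 2.
  by rewrite divr_gt0.
have [_ [x0 _ <-]] := sup_adherent q2 hsup.
rewrite -[sup G]/(dK Y X); set q := `|D x0| => hq.
have q0 : 0 < q by lra.
have Dq x : `|D x| <= 2 * q.
  by apply: (@le_trans _ _ (dK Y X)); [apply: sup_upper_bound => //; exists x|lra].
suff : q <= Num.max (32 * (512 * (B / k) / L)) (64 * eps * L).
  rewrite le_max => /orP[]; lra.
rewrite le_max; apply/orP.
pose M := 8 * (B / k); have M0 : 0 < M by rewrite !mulr_gt0 ?invr_gt0.
(* Over a length [2 a] the distribution function of [X] grows by at most [2 a M = q / 2]; the window
   is centred at [x0 + a] or [x0 - a]. *)
pose a := q / (4 * M).
have aM : a * M = q / 4 by rewrite /a; field; rewrite gt_eqF.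
(* If the window at scale [1 / L] does not fit, then [q = 4 M a] is already of order [1 / L]. *)
have [aL|aL] := leP (a * L) 512.
  left; rewrite -(ler_pM2r L0).
  have -> : 32 * (512 * (B / k) / L) * L = 512 * (4 * M).
    by rewrite /M; field; rewrite !gt_eqF.
  have -> : q * L = (a * L) * (4 * M) by rewrite /a; field; rewrite gt_eqF.
  by rewrite ler_pM2r// mulr_gt0.
right.
have lip x y : x <= y -> fine (cdf X y) - fine (cdf X x) <= M * (y - x).
  by move=> xy; exact: (cdf_lipschitz k0 xy Bc Bs).
have mon x y : x <= y -> fine (cdf Y x) <= fine (cdf Y y).
  by move=> xy; rewrite fine_le ?fin_num_measure// cdf_nondecreasing.
have ra r : `|r| <= 512 -> - a <= r / L <= a.
  move=> r512; rewrite -ler_norml normrM [`|L^-1|]gtr0_norm ?invr_gt0//.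
  by rewrite ler_pdivrMr// (le_trans r512)// ltW.
have [Dx0|Dx0] := leP 0 (D x0).
- apply: (@cdf_gap_le L eps q 1 (x0 + a)) => //; first by rewrite normr1.
  move=> r /ra /andP[r1 r2]; rewrite mul1r.
  have hx : x0 <= x0 + a - r / L by lra.
  have := lip _ _ hx; have := mon _ _ hx.
  have qE : q = D x0 by rewrite /q ger0_norm.
  by move: qE; rewrite /D; nra.
- apply: (@cdf_gap_le L eps q (-1) (x0 - a)) => //.
    by rewrite normrN normr1.
  move=> r /ra /andP[r1 r2]; rewrite mulN1r.
  have hx : x0 - a - r / L <= x0 by lra.
  have := lip _ _ hx; have := mon _ _ hx.
  have qE : q = - D x0 by rewrite /q ltr0_norm.
  by move: qE; rewrite /D; nra.
Qed.

End esseen.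


(** * The exponent of a stable law *)

Section stable_integrals.
Context {R : realType} (alpha : R) (c1 c2 : {nonneg R}).
Hypothesis alpha12 : 1 < alpha < 2.
Local Notation mu := (@lebesgue_measure R).
Local Notation nu := (stable_levy alpha c1 c2).
Local Notation dens := (stable_levy_density alpha c1 c2).
Local Open Scope complex_scope.

Lemma Re_levy_exponent (b : R) (la : {measure set R -> \bar R}) (t : R) :
  complex.Re (levy_exponent b la t) = \int[la]_u (cos (t * u) - 1).
Proof.
rewrite /levy_exponent /Cintegral raddfD /= !mulr0 !mul0r subrr add0r.
apply: eq_Rintegral => u _.
by rewrite /expC /= !mul0r !subr0 add0r !mul1r expR0 mul1r.
Qed.

Lemma Im_levy_exponent (b : R) (la : {measure set R -> \bar R}) (t : R) :
  complex.Im (levy_exponent b la t) =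
  t * b + \int[la]_u (sin (t * u) - t * u * \1_[set v : R | `|v| <= 1] u).
Proof.
rewrite /levy_exponent /Cintegral raddfD /= !mul0r !mul1r add0r; congr (_ + _).
apply: eq_Rintegral => u _.
by rewrite /expC /= !mul0r !subr0 !add0r !mul1r expR0 mul1r.
Qed.

Lemma stable_integralE (f : R -> R) : measurable_fun setT f ->
  (forall x, 0 <= f x) ->
  (\int[nu]_x (f x)%:E = \int[mu]_x (f x * dens x)%:E)%E.
Proof.
move=> mf f0.
have mid : measurable_fun setT (idfun : measurableTypeR R -> R).
  by move=> _ Y mY; rewrite setTI.
(* Lebesgue measure transported by the identity to the measurable structure that carries [nu]. *)
pose la := pushforward lebesgue_measure (idfun : measurableTypeR R -> R).
have mdens := measurable_stable_levy_density alpha c1 c2.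
have dens0 := stable_levy_density_ge0 alpha c1 c2.
have laE (A : set R) (k : R -> R) : measurable A -> measurable_fun setT k ->
    (forall x, 0 <= k x) ->
    (\int[la]_(x in A) (k x)%:E = \int[mu]_(x in A) (k x)%:E)%E.
  move=> mA mk k0; rewrite ge0_integral_pushforward//.
  - by apply/measurable_funTS/measurable_EFinP.
  - by move=> x _; rewrite lee_fin.
transitivity (\int[la]_x (f x * dens x)%:E)%E; last first.
  by apply: laE => //; [exact: measurable_funM|move=> x; exact: mulr_ge0].
rewrite (@ge0_integral_density R _ _ la nu dens (EFin \o f))//.
- by move=> A mA; rewrite laE.
- exact/measurable_EFinP.
Qed.

Lemma integral_powR (a b p : R) : 0 < a -> a <= b -> p != 0 ->
  (\int[mu]_(x in `[a, b]) (x `^ (p - 1))%:E = ((b `^ p - a `^ p) / p)%:E)%E.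
Proof.
move=> a0; rewrite le_eqVlt => /predU1P[<-|ab] p0.
  by rewrite set_itv1 integral_set1 subrr mul0r.
have dF (x : R) : 0 < x -> is_derive x 1 (fun x => x `^ p / p) (x `^ (p - 1)).
  move=> x0; have Dp := is_derive1_powR p x0.
  apply: (is_derive_eq (is_deriveM Dp (is_derive_cst (p^-1) x 1))).
  by rewrite scaler0 add0r /GRing.scale/=; field.
have cP (q x : R) : 0 < x -> {for x, continuous (fun x => x `^ q)}.
  move=> x0; have [D _] := is_derive1_powR q x0.
  exact/differentiable_continuous/derivable1_diffP.
rewrite (@continuous_FTC2 _ (fun x => x `^ (p - 1)) (fun x => x `^ p / p))//.
- by rewrite -EFinB mulrBl.
- apply: continuous_in_subspaceT => x /set_mem; rewrite /= in_itv/= => /andP[ax _].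
  exact/cP/(lt_le_trans a0).
- split.
  + move=> x; rewrite in_itv/= => /andP[ax _].
    by have [] := dF x (lt_trans a0 ax).
  + apply: cvg_at_right_filter; apply: cvgM; last exact: cvg_cst.
    exact: cP.
  + apply: cvg_at_left_filter; apply: cvgM; last exact: cvg_cst.
    by apply: cP; exact: lt_trans ab.
- move=> x; rewrite in_itv/= => /andP[ax _].
  by rewrite derive1E; have [] := dF x (lt_trans a0 ax).
Qed.

(** The integrand may blow up at 0, so []0, 1]] is exhausted by the intervals [[1 / (i + 1), 1]], on
    which the primitive gives a uniform bound. *)
Lemma integral_powR_0_1 (p : R) : 0 < p ->
  (\int[mu]_(x in `]0%R, 1%R]) (x `^ (p - 1))%:E <= (1 / p)%:E)%E.
Proof.
move=> p0.
have -> : `]0, 1]%classic = \bigcup_i `[i.+1%:R^-1, 1]%classic :> set R.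
  apply/seteqP; split=> x /=; rewrite ?in_itv/=.
    move=> /andP[x0 x1]; exists (Num.truncn x^-1) => //=; rewrite in_itv/= x1 andbT.
    by rewrite invf_ple ?posrE// ltW// truncnS_gt.
  move=> [i _]; rewrite /= in_itv/= => /andP[ix ->]; rewrite andbT.
  by rewrite (lt_le_trans _ ix)// invr_gt0.
apply: ge0_integral_bigcup_le.
- move=> m n mn; apply/subsetPset => x /=; rewrite !in_itv/= => /andP[mx ->].
  by rewrite andbT (le_trans _ mx)// lef_pV2 ?posrE// ler_nat.
- by move=> i; exact: measurable_itv.
- by apply/measurable_EFinP; exact: measurable_powR.
- by move=> i x _; rewrite lee_fin powR_ge0.
- move=> i; rewrite integral_powR ?invr_gt0// ?gt_eqF//; last first.
    by rewrite invf_le1// ler1n.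
  by rewrite lee_fin ler_pM2r ?invr_gt0// powR1 lerBlDr lerDl powR_ge0.
Qed.

Lemma integral_powR_1_y (p : R) : 0 < p ->
  (\int[mu]_(x in `[1%R, +oo[) (x `^ (- p - 1))%:E <= (1 / p)%:E)%E.
Proof.
move=> p0.
have -> : `[1, +oo[%classic = \bigcup_i `[1, i.+1%:R]%classic :> set R.
  apply/seteqP; split=> x /=; rewrite ?in_itv/= ?andbT.
    move=> x1; exists (Num.truncn x) => //=; rewrite in_itv/= x1/=.
    by rewrite ltW// truncnS_gt.
  by move=> [i _]; rewrite /= in_itv/= => /andP[].
apply: ge0_integral_bigcup_le.
- move=> m n mn; apply/subsetPset => x /=; rewrite !in_itv/= => /andP[-> xm].
  by rewrite (le_trans xm)// ler_nat.
- by move=> i; exact: measurable_itv.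
- by apply/measurable_EFinP; exact: measurable_powR.
- by move=> i x _; rewrite lee_fin powR_ge0.
- move=> i; rewrite integral_powR ?ler1n// ?oppr_eq0 ?gt_eqF//.
  rewrite lee_fin invrN mulrN -mulNr opprB ler_pM2r ?invr_gt0// powR1.
  by rewrite lerBlDr lerDl powR_ge0.
Qed.

Let g (u : R) := Num.min (u ^+ 2) `|u|.

Let g0 u : 0 <= g u.
Proof. by rewrite /g le_min sqr_ge0 normr_ge0. Qed.

Let mg : measurable_fun setT g.
Proof.
by apply: measurable_minr; [exact: exprn_measurable|exact: normr_measurable].
Qed.

Lemma stable_levy_density_le u :
  dens u <= (c1%:num + c2%:num) * (`|u| `^ (- alpha - 1)).
Proof.
rewrite /stable_levy_density -opprD powRN mulrDl.
have P0 : 0 <= (`|u| `^ (alpha + 1))^-1 by rewrite invr_ge0 powR_ge0.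
apply: lerD; rewrite indicE.
- case: (boolP (u \in _)) => [/set_mem|_]; last by rewrite mulr0 mulr_ge0.
  by rewrite /= in_itv/= andbT => u0; rewrite mulr1 gtr0_norm.
- case: (boolP (u \in _)) => [/set_mem|_]; last by rewrite mulr0 mulr_ge0.
  by rewrite mulr1.
Qed.

(* [min (u^2, |u|)] is the size of the integrand of the Levy exponent at 0 and
   at infinity; [alpha < 2] and [1 < alpha] respectively make it integrable. *)
Lemma stable_levy_min_integrable : (\int[nu]_u (g u)%:E < +oo)%E.
Proof.
have /andP[a1 a2] := alpha12.
rewrite stable_integralE//.
pose c := c1%:num + c2%:num.
have c0 : 0 <= c by rewrite addr_ge0.
pose h (u : R) := g u * `|u| `^ (- alpha - 1).
have h0 u : 0 <= h u by rewrite mulr_ge0// powR_ge0.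
have mh : measurable_fun setT h.
  apply: measurable_funM => //; apply: (measurableT_comp (measurable_powR _)).
  exact: normr_measurable.
have mhE (D : set R) : measurable_fun D (fun u => (h u)%:E).
  by apply: measurable_funTS; exact/measurable_EFinP.
have hE (u : R) (D : set R) : D u -> (0 <= (h u)%:E)%E by rewrite lee_fin.
apply: (@le_lt_trans _ _ (c%:E * \int[mu]_u (h u)%:E)%E).
  rewrite -ge0_integralZl//; last 2 first.
  - exact: mhE.
  - by move=> u _; rewrite lee_fin.
  apply: ge0_le_integral => //.
  - by move=> u _; rewrite lee_fin mulr_ge0// stable_levy_density_ge0.
  - apply/measurable_EFinP; apply: measurable_funM => //.
    exact: measurable_stable_levy_density.
  - by apply/measurable_EFinP; exact: measurable_funM.
  - move=> u _; rewrite lee_fin /h mulrCA ler_wpM2l//.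
    exact: stable_levy_density_le.
have h01 : (\int[mu]_(u in `]0%R, 1%R]) (h u)%:E <= (1 / (2 - alpha))%:E)%E.
  apply: (le_trans _ (integral_powR_0_1 _)); last by lra.
  apply: ge0_le_integral => //.
  - by move=> u _; rewrite lee_fin.
  - exact: mhE.
  - by apply/measurable_funTS/measurable_EFinP; exact: measurable_powR.
  - move=> u; rewrite /= in_itv/= => /andP[u0 u1]; rewrite lee_fin /h.
    rewrite gtr0_norm// (_ : 2 - alpha - 1 = 2 + (- alpha - 1)); last by ring.
    rewrite [leRHS]powRD; last by apply/implyP => _; rewrite gt_eqF.
    rewrite ler_wpM2r ?powR_ge0// /g powR_mulrn ?(ltW u0)//.
    by rewrite ge_min lexx.
have h1y : (\int[mu]_(u in `[1%R, +oo[) (h u)%:E <= (1 / (alpha - 1))%:E)%E.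
  apply: (le_trans _ (integral_powR_1_y _)); last by lra.
  apply: ge0_le_integral => //.
  - by move=> u _; rewrite lee_fin.
  - exact: mhE.
  - by apply/measurable_funTS/measurable_EFinP; exact: measurable_powR.
  - move=> u; rewrite /= in_itv/= andbT => u1; rewrite lee_fin /h.
    have u0 : 0 < u by exact: lt_le_trans u1.
    rewrite gtr0_norm// (_ : - (alpha - 1) - 1 = 1 + (- alpha - 1)); last by ring.
    rewrite [leRHS]powRD; last by apply/implyP => _; rewrite gt_eqF.
    rewrite powRr1 ?(ltW u0)// ler_wpM2r ?powR_ge0// /g gtr0_norm//.
    by rewrite ge_min lexx orbT.
have hpos : (\int[mu]_(u in `]0%R, +oo[) (h u)%:E < +oo)%E.
  have -> : `]0, +oo[%classic = `]0, 1]%classic `|` `]1, +oo[%classic :> set R.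
    by rewrite -itv_bndbnd_setU// bnd_simp.
  rewrite ge0_integral_setU//=; last 3 first.
  - exact: mhE.
  - by move=> u _; rewrite lee_fin.
  - rewrite disj_set2E; apply/eqP/seteqP; split => // u /=.
    by rewrite !in_itv/= andbT => -[/andP[_ u1]]; rewrite ltNge u1.
  rewrite lte_add_pinfty//; first exact: le_lt_trans h01 (ltry _).
  by rewrite integral_itv_obnd_cbnd//; exact: le_lt_trans h1y (ltry _).
have hN u : h (- u) = h u by rewrite /h /g normrN sqrrN.
have hneg : (\int[mu]_(u in `]-oo, 0%R[) (h u)%:E < +oo)%E.
  rewrite ge0_integral_oppr; [|by []|exact: mhE|by move=> u _; rewrite lee_fin].
  rewrite (_ : _ @^-1` _ = `]0, +oo[%classic); last first.
    by apply/seteqP; split=> u /=; rewrite !in_itv/= ltrNl oppr0 andbT.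
  by under eq_integral do rewrite hN.
rewrite lte_mul_pinfty// -(setUv (`]-oo, 0[%classic : set R)).
rewrite ge0_integral_setU//=; last 4 first.
- exact: measurableC.
- exact: mhE.
- by move=> u _; rewrite lee_fin.
- exact/disj_setPCl.
by rewrite lte_add_pinfty// setCitvl -integral_itv_obnd_cbnd//; exact: mhE.
Qed.

Let G := \int[nu]_u g u.

Let intg : nu.-integrable setT (EFin \o g).
Proof.
apply/integrableP; split; first exact/measurable_EFinP.
under eq_integral do rewrite /= ger0_norm//.
exact: stable_levy_min_integrable.
Qed.

Let stable_integral_bounded (f : R -> R) (t : R) : 0 <= t ->
  measurable_fun setT f -> (forall u, `|f u| <= (t + t ^+ 2) * g u) ->
  nu.-integrable setT (EFin \o f) /\ `|\int[nu]_u f u| <= G * (t + t ^+ 2).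
Proof.
move=> t0 mf fg.
have tt0 : 0 <= t + t ^+ 2 by rewrite addr_ge0// sqr_ge0.
have itg : nu.-integrable setT (EFin \o (fun u => (t + t ^+ 2) * g u)).
  exact: (integrableZl measurableT _ intg).
have itf : nu.-integrable setT (EFin \o f).
  apply: (@le_integrable _ _ _ nu setT measurableT _ _ _ _ itg).
    exact/measurable_EFinP.
  by move=> u _ /=; rewrite lee_fin [leRHS]ger0_norm ?mulr_ge0.
split => //; apply: (le_trans (le_normr_Rintegral measurableT itf)).
rewrite mulrC -RintegralZl//; apply: le_Rintegral => //.
exact: integrable_norm.
Qed.

Let cos_bound t u : 0 <= t -> `|cos (t * u) - 1| <= (t + t ^+ 2) * g u.
Proof.
move=> t0; rewrite distrC /g /Num.min; case: ifPn => _.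
- have : `|1 - cos (t * u)| <= (t * u) ^+ 2.
    by rewrite ger0_norm ?onem_cos_le_sqr// subr_ge0 cos_le1.
  by move=> /le_trans; apply; rewrite exprMn mulrDl lerDr mulr_ge0// sqr_ge0.
- apply: (le_trans (onem_cos_le_norm _)).
  by rewrite normrM (ger0_norm t0) mulrDl lerDl mulr_ge0// sqr_ge0.
Qed.

(** The truncation of the compensator at [|u| <= 1] is exactly where [min (u^2, |u|)] changes
    branch: quadratic bound inside, linear bound outside. *)
Let sin_bound t u : 0 <= t ->
  `|sin (t * u) - t * u * \1_[set v : R | `|v| <= 1] u| <= (t + t ^+ 2) * g u.
Proof.
move=> t0; rewrite indicE; case: (boolP (u \in _)) => [/set_mem /= u1|/negP u1].
- have gE : g u = u ^+ 2.
    rewrite /g; apply/min_idPl; rewrite -(real_normK (num_real u)) expr2.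
    by rewrite ler_piMl.
  rewrite mulr1 gE; apply: (le_trans (sinB_le_sqr _)).
  by rewrite exprMn mulrDl lerDr mulr_ge0// sqr_ge0.
- have {}u1 : 1 < `|u|.
    by rewrite ltNge; apply/negP => u1'; apply: u1; exact/mem_set.
  have gE : g u = `|u|.
    rewrite /g; apply/min_idPr; rewrite -(real_normK (num_real u)) expr2.
    by rewrite ler_peMl// ltW.
  rewrite mulr0 subr0 gE; apply: (le_trans (sin_le_norm _)).
  by rewrite normrM (ger0_norm t0) mulrDl lerDl mulr_ge0// sqr_ge0.
Qed.

Let mcosB t : measurable_fun setT (fun u : R => cos (t * u) - 1).
Proof.
apply: measurable_funB => //; apply: (measurableT_comp measurable_cos).
exact: measurable_funM.
Qed.

Let msinB t : measurable_fun setT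
  (fun u : R => sin (t * u) - t * u * \1_[set v : R | `|v| <= 1] u).
Proof.
apply: measurable_funB.
  by apply: (measurableT_comp measurable_sin); exact: measurable_funM.
apply: measurable_funM; first exact: measurable_funM.
apply: measurable_indic; rewrite (_ : [set v | _] = `[-1, 1]%classic)//.
by apply/seteqP; split => v /=; rewrite in_itv/= ler_norml.
Qed.

Lemma stable_exponent_bounded (b : R) : exists2 A, 0 < A & forall t, 0 <= t ->
  `|complex.Re (levy_exponent b nu t)| <= A * (t + t ^+ 2) /\
  `|complex.Im (levy_exponent b nu t)| <= A * (t + t ^+ 2).
Proof.
have G0 : 0 <= G by apply: Rintegral_ge0 => u _.
(* The drift contributes [|b| t], the integral [G (t + t^2)]; the 1 ensures positivity. *)
exists (`|b| + G + 1) => [|t t0]; first by rewrite ltr_pwDr// addr_ge0.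
have tt0 : 0 <= t ^+ 2 by exact: sqr_ge0.
have b0 := normr_ge0 b.
have [_ h1] := stable_integral_bounded t0 (mcosB t) (fun u => cos_bound u t0).
have [_ h2] := stable_integral_bounded t0 (msinB t) (fun u => sin_bound u t0).
rewrite Re_levy_exponent Im_levy_exponent; split.
  apply: (le_trans h1); rewrite ler_wpM2r ?addr_ge0//; lra.
apply: (le_trans (ler_normD _ _)); rewrite normrM (ger0_norm t0).
apply: (le_trans (lerD (lexx _) h2)); nra.
Qed.

(** On [A] one has [1/2 <= |t u| <= 1], hence [1 - cos (t u) >= 1/32], and a density of at least
    [c t^(alpha + 1)]. Multiplying by the length [1 / (2 t)] of [A] gives [c t^alpha / 64]. *)
Let onem_cos_ge (c t : R) (A : set R) : 0 < c -> 0 < t -> measurable A ->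
  mu A = ((2 * t)^-1)%:E ->
  (forall u, A u -> (2 * t)^-1 <= `|u| <= t^-1) ->
  (forall u, A u -> c * (`|u| `^ (alpha + 1))^-1 <= dens u) ->
  \int[nu]_u (cos (t * u) - 1) <= - (c / 64 * t `^ alpha).
Proof.
have /andP[a1 a2] := alpha12.
move=> c0 t0 mA muA Au Adens.
have oc0 u : 0 <= 1 - cos (t * u) by rewrite subr_ge0 cos_le1.
have [icos _] := stable_integral_bounded (ltW t0) (mcosB t)
  (fun u => cos_bound u (ltW t0)).
have mo : measurable_fun setT (fun u : R => 1 - cos (t * u)).
  have -> : (fun u => 1 - cos (t * u)) = \- (fun u => cos (t * u) - 1).
    by apply/funext => u /=; rewrite opprB.
  exact: measurable_funN.
have -> : \int[nu]_u (cos (t * u) - 1) = - \int[nu]_u (1 - cos (t * u)).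
  rewrite -[RHS]mulN1r -RintegralZl//.
    by apply: eq_Rintegral => u _; rewrite mulN1r opprB.
  have -> : EFin \o (fun u => 1 - cos (t * u)) =
      EFin \o (fun u => -1 * (cos (t * u) - 1)).
    by apply/funext => u /=; rewrite mulN1r opprB.
  exact: (integrableZl measurableT _ icos).
rewrite lerN2 -lee_fin /Rintegral fineK; last first.
  apply: integrable_fin_num => //.
  have -> : (fun u => (1 - cos (t * u))%:E) =
      EFin \o (fun u => -1 * (cos (t * u) - 1)).
    by apply/funext => u /=; rewrite mulN1r opprB.
  exact: (integrableZl measurableT _ icos).
rewrite stable_integralE//.
have md : measurable_fun setT (fun u => ((1 - cos (t * u)) * dens u)%:E).
  apply/measurable_EFinP; apply: measurable_funM => //.
  exact: measurable_stable_levy_density.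
have md0 u : (0 <= ((1 - cos (t * u)) * dens u)%:E)%E.
  by rewrite lee_fin mulr_ge0// stable_levy_density_ge0.
apply: (@le_trans _ _ (\int[mu]_(u in A) ((1 - cos (t * u)) * dens u)%:E)%E);
  last exact: ge0_subset_integral.
pose m := 1 / 32 * (c * t `^ (alpha + 1)).
have m0 : 0 <= m by rewrite !mulr_ge0 ?powR_ge0// ltW.
apply: (@le_trans _ _ (\int[mu]_(u in A) m%:E)%E).
  rewrite integral_cst// [X in (_ * X)%E]muA -EFinM lee_fin /m.
  rewrite (powRD (r := alpha)); last by apply/implyP => _; rewrite gt_eqF.
  rewrite powRr1 ?(ltW t0)// le_eqVlt; apply/orP; left; apply/eqP; field.
  by rewrite gt_eqF.
apply: ge0_le_integral => //.
- exact: measurable_funTS.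
- move=> u Au'; rewrite lee_fin /m.
  have /andP[u1 u2] := Au u Au'.
  have u0 : 0 < `|u| by rewrite (lt_le_trans _ u1)// invr_gt0 mulr_gt0.
  apply: ler_pM => //.
  + by rewrite mulr_ge0 ?powR_ge0// ltW.
  + have tu : `|t * u| <= 1.
      by rewrite normrM (gtr0_norm t0) mulrC -ler_pdivlMr// mul1r.
    apply: (le_trans _ (sqr_le_onem_cos tu)).
    have h : 1 / 2 <= `|t * u|.
      have -> : 1 / 2 = t * (2 * t)^-1 by field; rewrite gt_eqF.
      by rewrite normrM (gtr0_norm t0) ler_pM2l.
    rewrite -(real_normK (num_real (t * u))); nra.
  + apply: (le_trans _ (Adens u Au')); rewrite ler_pM2l//.
    rewrite -[leLHS]invrK lef_pV2 ?posrE ?invr_gt0 ?powR_gt0//.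
    rewrite -powRN -mulN1r powRrM powR_inv1 ?(ltW t0)//.
    by apply: ge0_ler_powR; rewrite ?nnegrE ?invr_ge0//; lra.
Qed.

Lemma Re_stable_exponent_le (b : R) : 0 < c1%:num + c2%:num ->
  exists2 k, 0 < k & forall t, 0 <= t ->
    complex.Re (levy_exponent b nu t) <= - (k * t `^ alpha).
Proof.
move=> c12; have /andP[a1 a2] := alpha12.
have t0E k : complex.Re (levy_exponent b nu 0) <= - (k * 0 `^ alpha).
  rewrite Re_levy_exponent powR0 ?gt_eqF//; last by lra.
  under eq_Rintegral do rewrite mul0r cos0 subrr.
  by rewrite /Rintegral integral0 mulr0 oppr0.
have h (t : R) : 0 < t -> (2 * t)^-1 < t^-1.
  by move=> t0; rewrite ltf_pV2 ?posrE ?mulr_gt0// ltr_pMl//; lra.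
have E (t : R) : 0 < t -> t^-1 - (2 * t)^-1 = (2 * t)^-1.
  by move=> t0; field; rewrite gt_eqF.
have hp (t : R) : 0 < t -> 0 < (2 * t)^-1 by move=> t0; rewrite invr_gt0 mulr_gt0.
(* One of the two half-lines carries jumps; the set [A] is taken on that side. *)
have [c10|c10] := ltP 0 c1%:num.
- exists (c1%:num / 64) => [|t]; first by rewrite divr_gt0.
  rewrite le_eqVlt => /predU1P[<-//|t0]; rewrite Re_levy_exponent.
  apply: (@onem_cos_ge _ _ `[(2 * t)^-1, t^-1]%classic) => //.
  + by rewrite lebesgue_measure_itv/= lte_fin h// -EFinB E.
  + move=> u; rewrite /= in_itv/= => /andP[u1 u2].
    by rewrite gtr0_norm ?u1// (lt_le_trans (hp t t0)).
  + move=> u; rewrite /= in_itv/= => /andP[u1 u2].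
    have u0 : 0 < u by rewrite (lt_le_trans (hp t t0)).
    rewrite /stable_levy_density gtr0_norm// !indicE mem_set/=; last first.
      by rewrite in_itv/= u0.
    by rewrite mulr1 lerDl mulr_ge0// mulr_ge0// invr_ge0 powR_ge0.
- have {c10}c20 : 0 < c2%:num by lra.
  exists (c2%:num / 64) => [|t]; first by rewrite divr_gt0.
  rewrite le_eqVlt => /predU1P[<-//|t0]; rewrite Re_levy_exponent.
  apply: (@onem_cos_ge _ _ `[- t^-1, - (2 * t)^-1]%classic) => //.
  + rewrite lebesgue_measure_itv/= lte_fin ltrN2 h// -EFinB opprK addrC E//.
  + move=> u; rewrite /= in_itv/= => /andP[u1 u2]; have := hp t t0 => h2.
    by rewrite ltr0_norm; [apply/andP; split; lra|lra].
  + move=> u; rewrite /= in_itv/= => /andP[u1 u2]; have := hp t t0 => h2.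
    have u0 : u < 0 by lra.
    rewrite /stable_levy_density !indicE.
    rewrite [in leRHS](mem_set (A := `]-oo, 0[%classic))/=; last first.
      by rewrite in_itv/= u0.
    by rewrite mulr1 lerDr mulr_ge0// mulr_ge0// invr_ge0 powR_ge0.
Qed.

End stable_integrals.

(** * Accompanying compound Poisson laws *)

Section compound_poisson_exponent.
Context {R : realType}.
Local Open Scope complex_scope.

Lemma charfunE d (T : measurableType d) (P : probability T R) (X : {RV P >-> R})
  (t : R) : charfun P X t = cos_mean X t +i* sin_mean X t.
Proof.
rewrite /charfun /Cintegral /expC; congr (_ +i* _); apply: eq_Rintegral => w _.
- by rewrite /= !mul0r ?mulr0 ?subr0 ?subrr expR0 !mul1r ?add0r ?addr0.
- by rewrite /= !mul0r ?mulr0 ?subr0 ?subrr expR0 !mul1r ?add0r ?addr0.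
Qed.

Lemma cf_means d (T : measurableType d) (P : probability T R) (X : {RV P >-> R})
    (t : R) (z : R[i]) : charfun P X t = expC z ->
  cos_mean X t = expR (complex.Re z) * cos (complex.Im z) /\
  sin_mean X t = expR (complex.Re z) * sin (complex.Im z).
Proof. by rewrite charfunE => -[-> ->]. Qed.

Lemma Re_natmul (n : nat) (z : R[i]) : complex.Re (n%:R * z) = n%:R * complex.Re z.
Proof. by case: z => x y; rewrite -(rmorph_nat (real_complex R))/= mul0r subr0. Qed.

Lemma Im_natmul (n : nat) (z : R[i]) : complex.Im (n%:R * z) = n%:R * complex.Im z.
Proof. by case: z => x y; rewrite -(rmorph_nat (real_complex R))/= mul0r addr0. Qed.

Lemma Re_natdiv (n : nat) (z : R[i]) :
  complex.Re (n%:R^-1 * z) = complex.Re z / n%:R.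
Proof.
case: z => x y.
by rewrite -(rmorph_nat (real_complex R)) -fmorphV/= mul0r subr0 mulrC.
Qed.

Lemma Im_natdiv (n : nat) (z : R[i]) :
  complex.Im (n%:R^-1 * z) = complex.Im z / n%:R.
Proof.
case: z => x y.
by rewrite -(rmorph_nat (real_complex R)) -fmorphV/= mul0r addr0 mulrC.
Qed.

Lemma Re_accompanying_exponent (n : nat) (z : R[i]) :
  complex.Re (n%:R * (expC (n%:R^-1 * z) - 1)) =
  n%:R * (expR (complex.Re z / n%:R) * cos (complex.Im z / n%:R) - 1).
Proof. by rewrite Re_natmul raddfB/= Re_natdiv Im_natdiv. Qed.

Lemma Im_accompanying_exponent (n : nat) (z : R[i]) :
  complex.Im (n%:R * (expC (n%:R^-1 * z) - 1)) =
  n%:R * (expR (complex.Re z / n%:R) * sin (complex.Im z / n%:R)).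
Proof. by rewrite Im_natmul raddfB/= Re_natdiv Im_natdiv subr0. Qed.

(** [N (e^(z / N) - 1) - z] for [z = a + i p] is [N] times a second-order remainder at [z / N],
    hence of order [|z|^2 / N]. *)
Lemma accompanying_exponent_close (N a p : R) : 0 < N -> a <= 0 ->
  `|N * (expR (a / N) * cos (p / N) - 1) - a| +
  `|N * (expR (a / N) * sin (p / N)) - p| <= 3 * ((a ^+ 2 + p ^+ 2) / N).
Proof.
move=> N0 a0.
have aN : a / N <= 0 by rewrite pmulr_lle0 ?invr_gt0.
have h1 : `|N * (expR (a / N) * cos (p / N) - 1) - a| <= (a ^+ 2 + p ^+ 2) / N.
  have -> : N * (expR (a / N) * cos (p / N) - 1) - a =
    N * (expR (a / N) * cos (p / N) - 1 - a / N) by field; rewrite gt_eqF.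
  have -> : (a ^+ 2 + p ^+ 2) / N = N * ((a / N) ^+ 2 + (p / N) ^+ 2).
    by field; rewrite gt_eqF.
  by rewrite normrM gtr0_norm// ler_pM2l// expR_cosB1_le.
have h2 : `|N * (expR (a / N) * sin (p / N)) - p| <= 2 * ((a ^+ 2 + p ^+ 2) / N).
  have -> : N * (expR (a / N) * sin (p / N)) - p =
    N * (expR (a / N) * sin (p / N) - p / N) by field; rewrite gt_eqF.
  have -> : 2 * ((a ^+ 2 + p ^+ 2) / N) = N * (2 * ((a / N) ^+ 2 + (p / N) ^+ 2)).
    by field; rewrite gt_eqF.
  by rewrite normrM gtr0_norm// ler_pM2l// expR_sinB_le.
lra.
Qed.

(* From [e^x >= 1 + x]: [1 - e^(-x) >= x / (1 + x)] for [x = s / N]. *)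
Lemma accompanying_exponent_le (N a p s k : R) : 0 < N -> 0 <= s ->
  a <= - s -> s / N <= k ->
  N * (expR (a / N) * cos (p / N) - 1) <= - (s / (1 + k)).
Proof.
move=> N0 s0 as_ sk.
have sN : 0 <= s / N by rewrite divr_ge0// ltW.
have e1 : expR (a / N) * cos (p / N) <= expR (- (s / N)).
  apply: (@le_trans _ _ (expR (a / N))).
    by rewrite ler_piMr ?expR_ge0// cos_le1.
  by rewrite ler_expR -mulNr ler_pM2r ?invr_gt0.
have e2 : expR (- (s / N)) <= (1 + s / N)^-1.
  rewrite expRN lef_pV2 ?posrE ?expR_gt0//; first exact: expR_ge1Dx.
  by rewrite ltr_pwDl.
have e3 : (1 + s / N)^-1 - 1 <= - (s / N / (1 + k)).
  have -> : (1 + s / N)^-1 - 1 = - (s / N / (1 + s / N)).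
    by field; rewrite !gt_eqF//; rewrite ltr_pwDl.
  rewrite lerN2 ler_wpM2l// lef_pV2 ?posrE ?lerD2l// ltr_pwDl//.
  exact: le_trans sk.
have -> : - (s / (1 + k)) = N * (- (s / N / (1 + k))).
  field; rewrite !gt_eqF// ltr_pwDl//; exact: le_trans sk.
by rewrite ler_pM2l//; lra.
Qed.

End compound_poisson_exponent.

(* [C] may depend on the drift [b] as well as on [alpha], [c1] and [c2]: no
   constant is valid for all drifts at once (take b of order sqrt n). *)
Theorem theorem4p4 (R : realType) (alpha : R) (c1 c2 : {nonneg R}) (b : R)
    (halpha : 1 < alpha < 2) (hc : 0 < c1%:num + c2%:num) :
  exists2 C : R, 0 < C &
    forall (d : measure_display) (T : measurableType d) (P : probability T R)
        (X : {RV P >-> R}),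
      (forall t : R, charfun P X t = stable_cf alpha c1 c2 b t) ->
    forall (n : nat), (1 <= n)%N ->
    forall (d' : measure_display) (T' : measurableType d')
        (Q : probability T' R) (Xn : {RV Q >-> R}),
      compound_poisson Xn ->
      (forall t : R, charfun Q Xn t =
         expC (n%:R * (stable_cf_root alpha c1 c2 b n t - 1))) ->
      dK Xn X <= C * (n%:R `^ (1 / (alpha + 1)))^-1.
Proof.
have /andP[a1 a2] := halpha.
pose psi := levy_exponent b (stable_levy alpha c1 c2).
have [A A0 psiA] := stable_exponent_bounded c1 c2 halpha b.
have [kap kap0 psik] := Re_stable_exponent_le halpha b hc.
have k10 : 0 < 1 + kap by rewrite addr_gt0.
(* The rate that survives the passage from [psi] to [psi_n]; being smaller than [kap], it serves
   both laws. *)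
pose k := kap / (1 + kap); have k0 : 0 < k by rewrite divr_gt0.
have kkap : k <= kap by rewrite ler_pdivrMr// ler_peMr ?(ltW kap0)// lerDl ltW.
have [Bd Bd0 hBd] := expRN_cube_bounded k0.
(* From [t^alpha >= t - 1]: [e^(- k t^alpha) <= e^k e^(- k t)]. *)
pose B := expR k; have B0 : 0 < B by exact: expR_gt0.
have decay (t x : R) : 0 <= t -> x <= - (k * t `^ alpha) ->
    expR x <= B * expR (- (k * t)).
  move=> t0 xt; rewrite -expRD ler_expR (le_trans xt)//.
  have : t - 1 <= t `^ alpha.
    have [t1|t1] := leP 1 t; last by have := powR_ge0 t alpha; lra.
    by have := le1r_powR t1 (ltW a1); lra.
  by move=> /(ler_wpM2l (ltW k0)); lra.
pose K := 6 * A ^+ 2 * B * Bd.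
have K0 : 0 < K by rewrite !mulr_gt0 ?exprn_gt0.
exists (64 * (512 * (B / k)) + 128 * K) => [|d T P X hX n n1 d' T' Q Xn _ hXn].
  have Bk0 : 0 < B / k by exact: divr_gt0.
  lra.
set N : R := n%:R; pose L := N `^ (1 / (alpha + 1)).
have N1 : 1 <= N by rewrite ler1n.
have N0 : 0 < N by lra.
have L0 : 0 < L by exact: powR_gt0.
have L1 : 1 <= L.
  by rewrite -(powRr0 N) /L ler_powR// divr_ge0; lra.
(* This keeps [t^alpha / n <= 1] on [[0, L]], as the decay of [phi_n] requires; [L * L <= N] below,
   from [2 <= alpha + 1], serves the final comparison of the two error terms. *)
have Lalpha : L `^ alpha <= N.
  rewrite /L -powRrM -[leRHS]powRr1 ?(ltW N0)// ler_powR//.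
  by rewrite mulrAC ler_pdivrMr; lra.
have LL : L * L <= N.
  rewrite /L -powRD; last by apply/implyP => _; rewrite gt_eqF.
  rewrite -[leRHS]powRr1 ?(ltW N0)// ler_powR//.
  by rewrite -mulrDl ler_pdivrMr; lra.
have meansX t := cf_means (hX t).
have meansY t := cf_means (hXn t).
have aX (t : R) : 0 <= t -> complex.Re (psi t) <= - (k * t `^ alpha).
  move=> t0; apply: (le_trans (psik t t0)).
  by rewrite lerN2 ler_wpM2r ?powR_ge0.
have boundX (t : R) : 0 <= t -> expR (complex.Re (psi t)) <= B * expR (- (k * t)).
  by move=> t0; apply: decay => //; exact: aX.
have diff (t : R) : 0 <= t <= L ->
    [/\ expR (complex.Re (n%:R * (stable_cf_root alpha c1 c2 b n t - 1))) <=
          B * expR (- (k * t)) &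
     B * expR (- (k * t)) *
      (`|complex.Re (n%:R * (stable_cf_root alpha c1 c2 b n t - 1)) -
         complex.Re (psi t)| +
       `|complex.Im (n%:R * (stable_cf_root alpha c1 c2 b n t - 1)) -
         complex.Im (psi t)|) <= K / N * t].
  move=> /andP[t0 tL].
  rewrite Re_accompanying_exponent Im_accompanying_exponent -/N -/(psi t).
  set a := complex.Re (psi t); set p := complex.Im (psi t).
  have ta0 : 0 <= t `^ alpha by exact: powR_ge0.
  have ak : a <= - (kap * t `^ alpha) by exact: psik.
  have tN : t `^ alpha / N <= 1.
    rewrite ler_pdivrMr// mul1r (le_trans _ Lalpha)//.
    by apply: ge0_ler_powR; rewrite ?nnegrE ?(ltW L0)//; lra.
  split.
    apply: decay => //.
    (* The decay lemma is applied with [s = kap t^alpha], for which [s / N <= kap]. *)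
    rewrite (_ : k * _ = kap * t `^ alpha / (1 + kap)); last by rewrite /k mulrAC.
    apply: accompanying_exponent_le => //; first by rewrite mulr_ge0// ltW.
    by rewrite -mulrA ler_piMr// ltW.
  have a0 : a <= 0 by rewrite (le_trans ak)// oppr_le0 mulr_ge0// ltW.
  have e0 : 0 <= B * expR (- (k * t)) by rewrite mulr_ge0// ?expR_ge0 ?ltW.
  apply: (le_trans (ler_wpM2l e0 (accompanying_exponent_close p N0 a0))).
  have [ha hp] := psiA t t0.
  have sq x : `|x| <= A * (t + t ^+ 2) -> x ^+ 2 <= (A * (t + t ^+ 2)) ^+ 2.
    by rewrite -(real_normK (num_real x)) => hx; apply: lerXn2r;
      rewrite ?nnegrE// (le_trans _ hx).
  have h6 : 3 * ((a ^+ 2 + p ^+ 2) / N) <= 6 * (A * (t + t ^+ 2)) ^+ 2 / N.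
    rewrite mulrA ler_pM2r ?invr_gt0//.
    by have := sq _ ha; have := sq _ hp; rewrite -/a -/p; lra.
  apply: (le_trans (ler_wpM2l e0 h6)).
  (* As [(t + t^2)^2 = t * (t (1 + t)^2)], one factor [t] is kept for the conclusion, and the rest
     is at most [(1 + t)^3], absorbed by the exponential. *)
  have -> : B * expR (- (k * t)) * (6 * (A * (t + t ^+ 2)) ^+ 2 / N) =
    6 * A ^+ 2 * B / N * t * (t * (1 + t) ^+ 2 * expR (- (k * t))).
    by field; rewrite gt_eqF.
  have -> : K / N * t = 6 * A ^+ 2 * B / N * t * Bd.
    by rewrite /K; field; rewrite gt_eqF.
  apply: ler_wpM2l; first by rewrite !mulr_ge0 ?invr_ge0 ?sqr_ge0// ltW.
  apply: le_trans (hBd t t0); rewrite ler_wpM2r ?expR_ge0//.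
  by rewrite [leRHS]exprS ler_wpM2r ?sqr_ge0//; lra.
have eN0 : 0 <= K / N by rewrite divr_ge0// ltW.
have := @esseen_smoothing R _ _ _ X _ _ _ Xn L (K / N) B k L0 eN0 B0 k0.
have cX (t : R) : 0 <= t -> `|cos_mean X t| <= B * expR (- (k * t)).
  move=> t0; rewrite (meansX t).1 normrM (le_trans _ (boundX t t0))//.
  by rewrite (ger0_norm (expR_ge0 _)) ler_piMr ?expR_ge0// cos_max.
have sX (t : R) : 0 <= t -> `|sin_mean X t| <= B * expR (- (k * t)).
  move=> t0; rewrite (meansX t).2 normrM (le_trans _ (boundX t t0))//.
  by rewrite (ger0_norm (expR_ge0 _)) ler_piMr ?expR_ge0// sin_max.
have cY (t : R) : 0 <= t <= L -> `|cos_mean Xn t - cos_mean X t| <= K / N * t.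
  move=> tL; have [h1 h2] := diff t tL; have /andP[t0 _] := tL.
  rewrite (meansX t).1 (meansY t).1; apply: le_trans h2.
  by apply: expR_cos_lipschitz => //; exact: boundX.
have sY (t : R) : 0 <= t <= L -> `|sin_mean Xn t - sin_mean X t| <= K / N * t.
  move=> tL; have [h1 h2] := diff t tL; have /andP[t0 _] := tL.
  rewrite (meansX t).2 (meansY t).2; apply: le_trans h2.
  by apply: expR_sin_lipschitz => //; exact: boundX.
move=> /(_ cX sX cY sY) /le_trans; apply.
have KL : K / N * L <= K / L.
  rewrite -mulrA ler_pM2l// mulrC ler_pdivrMr// ler_pdivlMl//.
have E (x y z w : R) : x * (y / L) + z * w * L = x * y / L + z * (w * L) by ring.
rewrite -/L E [leRHS]mulrDl; apply: lerD => //.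
by rewrite -[leRHS]mulrA ler_wpM2l// ler0n.
Qed.
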